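(* Let $\ell$ be a prime number and let $F$ be a global function field of characteristic $\ell$ with field of constants $\kappa$. Assume that $F$ has a prime $P_\infty$ of degree $1$, fix it, and let $\mathcal{O}_F$ be the corresponding ring of integers of $F$. Let $f(X)$ be a polynomial with coefficients in $\kappa$. Let $q\neq \ell$ be a prime number and let $k>0$ be the least integer such that $h_F[q^k]=h_F[q^{k-1}]$. Assume that the following conditions are satisfied. (1) $f(X)$ factorizes as $f(X)=a_0(X-a_1)^{n_1}\cdots (X-a_t)^{n_t}$, where $a_0\in \kappa$ is nonzero, $a_1,\dots,a_t$ are distinct elements of $\kappa$, $n_1,\dots,n_t$ are positive integers and $t\geq 2$. (2) At least two of the exponents $n_i$ are not divisible by $q$. Then any solution $(X,Y)$ to $Y^{q^k}=f(X)$ with $X,Y\in \mathcal{O}_F$ is constant, i.e., $X$ and $Y$ are both in $\kappa$.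
   Context: The field of constants $\kappa$ of $F$ is the algebraic closure of $\mathbb{F}_\ell$ in $F$; it is a finite field. A prime of $F$ is the maximal ideal of a discrete valuation ring in $F$ with fraction field $F$. The ring of integers $\mathcal{O}_F$ (with respect to $P_\infty$) is the ring of all functions in $F$ having no poles away from $P_\infty$. The class group of $F$ is the (finite) group of degree $0$ divisors of $F$ modulo principal divisors. For a natural number $N$, $h_F[N]$ denotes the cardinality of the $N$-torsion subgroup of the class group of $F$. *)

(* Defs.v *)
From HB Require Import structures.
From mathcomp Require Import all_boot all_order all_algebra all_field finmap.
From mathcomp Require Import boolp classical_sets functions cardinality.
From mathcomp.multinomials Require Import freeg.

Set Implicit Arguments.
Unset Strict Implicit.
Unset Printing Implicit Defensive.

Import GRing.Theory.

Local Open Scope classical_set_scope.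
Local Open Scope ring_scope.

Definition is_subring (F : fieldType) (V : set F) : Prop :=
  [/\ V 1, (forall x y, V x -> V y -> V (x - y))
         & (forall x y, V x -> V y -> V (x * y))].

Definition is_ideal (F : fieldType) (V I : set F) : Prop :=
  [/\ I `<=` V, I 0, (forall x y, I x -> I y -> I (x + y))
    & (forall a x, V a -> I x -> I (a * x))].

Definition is_maximal_ideal (F : fieldType) (V M : set F) : Prop :=
  [/\ is_ideal V M, M <> V
    & forall I : set F, is_ideal V I -> M `<=` I -> I = M \/ I = V].

Definition principal_ideal (F : fieldType) (V : set F) (a : F) : set F :=
  [set a * x | x in V].

(* A principal ideal domain with a unique maximal ideal, which is not a field
   (i.e. this maximal ideal is nonzero). *)
Definition is_dvr (F : fieldType) (V : set F) : Prop :=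
  [/\ is_subring V,
      (forall I : set F, is_ideal V I ->
         exists2 a, V a & I = principal_ideal V a)
    & exists M : set F, [/\ is_maximal_ideal V M, M <> [set 0]
        & forall M' : set F, is_maximal_ideal V M' -> M' = M]].

Definition has_fraction_field (F : fieldType) (V : set F) : Prop :=
  forall x : F, exists a b : F, [/\ V a, V b, b != 0 & x = a / b].

(* [max_ideal] is the prime itself.  Its ring [val_ring] is determined by it
   (and conversely), so that two primes are equal iff their ideals are. *)
Record prime_of (F : fieldType) := PrimeOf {
  val_ring : set F;
  max_ideal : set F;
  val_ring_dvr : is_dvr val_ring;
  val_ring_frac : has_fraction_field val_ring;
  max_idealP : is_maximal_ideal val_ring max_ideal
}.

HB.instance Definition _ (F : fieldType) := gen_eqMixin (prime_of F).
HB.instance Definition _ (F : fieldType) := gen_choiceMixin (prime_of F).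

(* The order of x at P: the n such that x = u pi ^ n with pi a uniformizer and
   u a unit of the valuation ring.  By convention ord P 0 = 0. *)
Definition ord (F : fieldType) (P : prime_of F) (x : F) : int :=
  xget 0 [set n : int | exists pi u : F,
    [/\ max_ideal P = principal_ideal (val_ring P) pi,
        val_ring P u, u != 0, val_ring P u^-1 & x = u * pi ^ n]].

(* O_F with respect to Pinf: the functions without poles away from Pinf. *)
Definition ring_of_integers (F : fieldType) (Pinf : prime_of F) : set F :=
  [set x | forall P : prime_of F, P <> Pinf -> 0 <= ord P x].

(* A global function field of characteristic ell is a finite extension of the
   field of fractions of the polynomial ring over 'F_ell. *)
Notation global_function_field ell :=
  (fieldExtType {fraction {poly 'F_ell}}).

Definition constants (ell : nat) (F : global_function_field ell) : set F :=
  [set x | algebraicOver (fun c : 'F_ell => (FracField.tofrac c%:P)%:A : F) x].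

Arguments constants {ell} F _.

(* e represents a basis of val_ring P / max_ideal P over the constants. *)
Definition is_residue_basis (ell : nat) (F : global_function_field ell)
    (P : prime_of F) (d : nat) (e : 'I_d -> F) : Prop :=
  [/\ (forall i, val_ring P (e i)),
      (forall x, val_ring P x -> exists c : 'I_d -> F,
         (forall i, constants F (c i)) /\
         max_ideal P (x - \sum_(i < d) c i * e i))
    & (forall c : 'I_d -> F, (forall i, constants F (c i)) ->
         max_ideal P (\sum_(i < d) c i * e i) -> forall i, c i = 0)].

Definition prime_degree (ell : nat) (F : global_function_field ell)
    (P : prime_of F) : nat :=
  xget 0%N [set d | exists e : 'I_d -> F, is_residue_basis P e].

Notation divisor F := {freeg (prime_of F) / int}.

Definition div_degree (ell : nat) (F : global_function_field ell)
    (D : divisor F) : int :=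
  \sum_(P <- dom D) coeff P D * (prime_degree P)%:Z.

Definition is_principal (F : fieldType) (D : divisor F) : Prop :=
  exists2 x : F, x != 0 & forall P : prime_of F, coeff P D = ord P x.

Definition div_class (F : fieldType) (D : divisor F) : set (divisor F) :=
  [set D' | is_principal (D' - D)].

(* The N-torsion of the class group, whose elements are the cosets [div_class D]
   with D of degree 0. *)
Definition class_group_torsion (ell : nat) (F : global_function_field ell)
    (N : nat) : set (set (divisor F)) :=
  [set div_class D | D in
     [set D : divisor F | div_degree D = 0 /\ is_principal (D *+ N)]].

Arguments class_group_torsion {ell} F N _.

(* [fset_set] sends an infinite set to the empty one, but the class group of a
   global function field is finite. *)
Definition class_number_torsion (ell : nat) (F : global_function_field ell)
    (N : nat) : nat :=
  #|` fset_set (class_group_torsion F N)|.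

Arguments class_number_torsion {ell} F N.

(* Main.v *)
(**
  Let X be a nonconstant solution, and let q not divide n_i.  Away from Pinf the
  functions X - a_j have no poles and no common zeros, so every ord_P (X - a_i)
  is divisible by q^k; so is the order at Pinf, because Pinf has degree 1 and
  principal divisors have degree 0.  Thus div (X - a_i) = q^k D with D of degree
  0, and as the q^k-torsion of the class group equals its q^(k-1)-torsion,
  q^(k-1) D = div beta, hence X - a_i = c beta^q with c constant.  Likewise
  X - a_j = d gamma^q.  Comparing leading terms at Pinf, d = c r^q for a constant
  r, so that beta^q - (r gamma)^q is a nonzero constant.  The cofactor of
  beta - r gamma in it has a pole at Pinf, so beta - r gamma has a zero at Pinf
  and no poles: it is 0, a contradiction.

  The facts on function fields behind this rest on \sum e f <= n for the places
  over a place of k(T) (weak approximation and counting), on the existence of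
  places (maximal subrings avoiding y^-1 are valuation rings, discrete because
  chains of ideals are bounded by the same counting), and on the lower half of
  Riemann's inequality, which gives both the degree formula and the finiteness
  of the class group.
*)

(* The field k is finite, so cardinalities take the place of dimensions throughout. Independence
   over k[x] is bounded by comparing numbers of coefficient vectors, and Riemann's inequality is a
   pigeonhole argument on residue classes. A second theme is the base field. Residue dimensions are
   first counted over k, where polynomials have their coefficients, while degrees of primes refer to
   the possibly larger field of constants kappa. The two differ by the factor [kappa : k], which is
   the same at every place and can be divided out of the degree formula and absorbed in the constant
   of Riemann's inequality. *)
From HB Require Import structures.
Require Import Defs.
From mathcomp Require Import all_boot all_order all_algebra all_field finmap.
From mathcomp Require Import boolp classical_sets cardinality zify ring.
From mathcomp.multinomials Require Import freeg.

Set Implicit Arguments.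
Unset Strict Implicit.
Unset Printing Implicit Defensive.

Import Order.TTheory GRing.Theory Num.Theory.

Local Open Scope classical_set_scope.
Local Open Scope ring_scope.

(** * Discrete valuations *)

(** [Zorn_bigcup] also tests the empty chain, whose union need not be good. It is therefore applied
    to the property that the union of A with [A0] is good: the empty chain then yields [A0], and the
    chain hypothesis is only called on nonempty chains. *)
Lemma Zorn_above (T : Type) (good : set T -> Prop) (A0 : set T) : good A0 ->
  (forall C : set (set T), C !=set0 -> total_on C subset ->
     (forall A, C A -> good A) -> good (\bigcup_(A in C) A)) ->
  exists A, [/\ good A, A0 `<=` A &
    forall B, good B -> A `<=` B -> B `<=` A].
Proof.
move=> good0 Hchain.
have [|A [gA Amax]] := @Zorn_bigcup _ (fun A => good (A `|` A0)).
  move=> C Cgood Ctot; have [->|/set0P C0] := eqVneq C set0.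
    by rewrite bigcup_set0 set0U.
  rewrite -bigcupUl //.
  rewrite -(bigcup_image C (fun A => A `|` A0) id); apply: Hchain.
  - by case: C0 => A CA; exists (A `|` A0), A.
  - move=> _ _ [A CA <-] [B CB <-].
    by have [AB|BA] := Ctot _ _ CA CB; [left|right]; apply: setSU.
  - by move=> _ [A CA <-]; apply: Cgood.
exists (A `|` A0); split=> // B gB AB x Bx; apply: contrapT => Ax.
have BA0 : B `|` A0 = B by apply/setUidPl => z A0z; apply: AB; right.
apply: (Amax B); last by rewrite BA0.
split; first by move=> z Az; apply: AB; left.
by move=> /(_ x Bx) ?; apply: Ax; left.
Qed.

Lemma chain_common (T : Type) (C : set (set T)) (x y : T) : total_on C subset ->
  (\bigcup_(A in C) A) x -> (\bigcup_(A in C) A) y ->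
  exists A, [/\ C A, A x & A y].
Proof.
move=> Ctot [A CA Ax] [B CB By].
by have [AB|BA] := Ctot _ _ CA CB; [exists B|exists A]; split=> //;
  [apply: AB|apply: BA].
Qed.

Section Dvr.
Variables (F : fieldType) (V : set F).
Hypothesis Vdvr : is_dvr V.

Let V1 : V 1. Proof. by case: Vdvr => -[]. Qed.
Let VB x y : V x -> V y -> V (x - y).
Proof. by case: Vdvr => -[_ H _ _ _]; apply: H. Qed.
Let VM x y : V x -> V y -> V (x * y).
Proof. by case: Vdvr => -[_ _ H _ _]; apply: H. Qed.
Let V0 : V 0. Proof. by rewrite -(subrr 1); apply: VB. Qed.
Let VN x : V x -> V (- x).
Proof. by move=> Vx; rewrite -sub0r; apply: VB. Qed.
Let VD x y : V x -> V y -> V (x + y).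
Proof. by move=> Vx Vy; rewrite -(opprK y); apply/VB/VN. Qed.

Lemma ideal_eq_ring (I : set F) : is_ideal V I -> I 1 -> I = V.
Proof.
case=> IV _ _ IM I1; apply/seteqP; split=> // x Vx.
by rewrite -(mulr1 x); apply: IM.
Qed.

Lemma principal_ideal_is_ideal a : V a -> is_ideal V (principal_ideal V a).
Proof.
move=> Va; split.
- by move=> _ [x Vx <-]; apply: VM.
- by exists 0; rewrite ?mulr0.
- by move=> _ _ [x Vx <-] [y Vy <-]; exists (x + y); rewrite ?mulrDr //; apply: VD.
- by move=> b _ Vb [x Vx <-]; exists (b * x); [apply: VM | rewrite mulrCA].
Qed.

Lemma ideal_sub_maximal (I M : set F) :
  (forall M', is_maximal_ideal V M' -> M' = M) ->
  is_ideal V I -> ~ I 1 -> I `<=` M.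
Proof.
move=> Muniq Iid I1.
have [//||A [[Aid A1] IA Amax]] := @Zorn_above _ (fun A => is_ideal V A /\ ~ A 1) I.
  move=> C [A0 CA0] Ctot Cgood; split; last by case=> A /Cgood[].
  split.
  - by move=> x [A /Cgood[[AV _ _ _] _]] /AV.
  - by exists A0 => //; case: (Cgood _ CA0) => -[].
  - move=> x y Ux Uy; have [A [CA Ax Ay]] := chain_common Ctot Ux Uy.
    by exists A => //; case: (Cgood _ CA) => -[_ _ AD _] _; apply: AD.
  - move=> a x Va [A CA Ax]; exists A => //.
    by case: (Cgood _ CA) => -[_ _ _ AM] _; apply: AM.
suff <- : A = M by [].
apply: Muniq; split=> // [E|J Jid AJ]; first by apply: A1; rewrite E.
have [J1|J1] := pselect (J 1); first by right; apply: ideal_eq_ring.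
by left; apply/seteqP; split=> //; apply: Amax.
Qed.

Lemma dvr_unit (M : set F) x :
  (forall M', is_maximal_ideal V M' -> M' = M) ->
  V x -> ~ M x -> V x^-1.
Proof.
move=> Muniq Vx Mx.
have [[y Vy xy1]|x1] := pselect (principal_ideal V x 1); last first.
  case: Mx; apply: (ideal_sub_maximal Muniq (principal_ideal_is_ideal Vx) x1).
  by exists 1; rewrite ?mulr1.
suff -> : x^-1 = y by [].
have x0 : x != 0 by apply: contra_eqN xy1 => /eqP ->; rewrite mul0r eq_sym oner_eq0.
by apply: (mulfI x0); rewrite xy1 divff.
Qed.

Lemma dvr_decomp (M : set F) :
  is_maximal_ideal V M ->
  exists pi, [/\ pi != 0, V pi, ~ V pi^-1, M = principal_ideal V pi &
   forall x, V x -> x != 0 -> exists n : nat, exists2 u,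
     [/\ u != 0, V u & V u^-1] & x = u * pi ^+ n].
Proof.
move=> Mmax; have [_ Vpid [M' [M'max M'0 Muniq]]] := Vdvr.
have ? := Muniq _ Mmax; subst M'.
have [Mid MV _] := Mmax.
have [pi Vpi EM] := Vpid _ Mid.
have Mpi : M pi by rewrite EM; exists 1; rewrite ?mulr1.
have pi0 : pi != 0.
  apply/eqP => pi0; apply: M'0; rewrite EM pi0.
  apply/seteqP; split=> x; first by case=> y _ <-; rewrite mul0r.
  by move=> ->; exists 0; rewrite ?mulr0.
have Vpi1 : ~ V pi^-1.
  move=> H; apply: MV; apply: ideal_eq_ring => //.
  by rewrite EM; exists pi^-1; rewrite ?divff.
exists pi; split=> // x Vx x0.
(* The intersection of the powers of the maximal ideal is generated by some b. It also contains b /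
   pi, so a nonzero b would make pi a unit. Hence it is zero, and a nonzero x is divisible by only
   finitely many powers of pi. *)
pose J := [set x | forall n, V (x / pi ^+ n)].
have Jid : is_ideal V J.
  split.
  - by move=> y /(_ 0%N); rewrite expr0 divr1.
  - by move=> n; rewrite mul0r.
  - by move=> y z Jy Jz n; rewrite mulrDl; apply: VD.
  - by move=> a y Va Jy n; rewrite -mulrA; apply: VM.
have [b Vb EJ] := Vpid _ Jid.
have Jb : J b by rewrite EJ; exists 1; rewrite ?mulr1.
have b0 : b = 0.
  apply/eqP; apply: contrapT => /negP b0; apply: Vpi1.
  have : J (b / pi) by move=> n; rewrite -mulrA -invfM -exprS; apply: Jb.
  by rewrite EJ => -[y Vy /(mulfI b0) <-].
have : exists n, `[< ~ V (x / pi ^+ n) >].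
  apply: contrapT => H; move: x0; suff : J x by rewrite EJ b0 => -[y _ <-];
    rewrite mul0r eqxx.
  by move=> n; apply: contrapT => Hn; apply: H; exists n; apply/asboolP.
move=> /ex_minnP [[|n]] /asboolP nVn nmin; first by case: nVn; rewrite expr0 divr1.
have Vn : V (x / pi ^+ n).
  by apply: contrapT => /asboolP /nmin; rewrite ltnn.
exists n, (x / pi ^+ n); last by rewrite divfK // expf_neq0.
split=> //; first by rewrite mulf_neq0 // invr_neq0 // expf_neq0.
apply: (dvr_unit Muniq Vn); rewrite EM => -[y Vy E]; apply: nVn.
by rewrite exprS invfM mulrCA -E mulKf.
Qed.

End Dvr.

(** Zero counts here as having infinite order, whereas [ord P 0 = 0]; with this reading the
    ultrametric inequality and the product rule hold without exceptions. *)
Definition vge (F : fieldType) (P : prime_of F) (m : int) (x : F) :=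
  (x == 0) || (m <= ord P x).

Section Ord.
Variables (F : fieldType) (P : prime_of F).
Local Notation V := (val_ring P).
Implicit Types (x y : F) (m n : int).

Let Vsub : is_subring V. Proof. by case: (val_ring_dvr P). Qed.
Let V1 : V 1. Proof. by case: Vsub. Qed.
Let VB x y : V x -> V y -> V (x - y). Proof. by case: Vsub => _ H _; apply: H. Qed.
Let VM x y : V x -> V y -> V (x * y). Proof. by case: Vsub => _ _ H; apply: H. Qed.
Let V0 : V 0. Proof. by rewrite -(subrr 1); apply: VB. Qed.
Let VX0 x k : V x -> V (x ^+ k).
Proof. by move=> Vx; elim: k => [|k IH]; rewrite ?expr0 ?exprS //; apply: VM. Qed.

Definition uniformizer_of (pi : F) :=
  [/\ pi != 0, V pi, ~ V pi^-1 & max_ideal P = principal_ideal V pi].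

Definition Vunit u := [/\ u != 0, V u & V u^-1].

Lemma VunitM u v : Vunit u -> Vunit v -> Vunit (u * v).
Proof.
by case=> u0 Vu Vu1 [v0 Vv Vv1]; split; rewrite ?mulf_neq0 ?invfM //; apply: VM.
Qed.

Lemma VunitV u : Vunit u -> Vunit u^-1.
Proof. by case=> u0 Vu Vu1; split; rewrite ?invr_eq0 ?invrK. Qed.

Lemma uniformizer_decomp : exists2 pi, uniformizer_of pi &
  forall x, x != 0 -> exists n : int, exists2 u, Vunit u & x = u * pi ^ n.
Proof.
have [pi [pi0 Vpi Vpi1 EM dec]] := dvr_decomp (val_ring_dvr P) (max_idealP P).
exists pi => // x x0; have [a [b [Va Vb b0 xE]]] := val_ring_frac P x.
have a0 : a != 0 by apply: contra_neq x0 => a0; rewrite xE a0 mul0r.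
have [n [u Uu aE]] := dec _ Va a0.
have [m [v Uv bE]] := dec _ Vb b0.
exists (n%:Z - m%:Z), (u / v); first by apply/VunitM/VunitV.
by rewrite expfzDr // -invr_expz xE aE bE invfM mulrACA -mulrA.
Qed.

(** The exponent in [ord] is chosen together with an arbitrary generator of the ideal. Two
    generators differ by a unit and a nontrivial power of pi is never a unit, so all choices
    agree. *)
Lemma ord_eq pi u x n : uniformizer_of pi -> Vunit u -> x = u * pi ^ n ->
  ord P x = n.
Proof.
move=> Upi Uu xE; rewrite /ord; case: xgetP => [m _|/(_ n)]; last first.
  case; exists pi, u; split=> //; by [case: Upi|case: Uu].
case=> pi' [u' [Epi' Vu' u'0 Vu'1 xE']].
have [pi0 Vpi Vpi1 Epi] := Upi; have [u0 Vu Vu1] := Uu.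
have Uu' : Vunit u' by [].
have [v Uv piE] : exists2 v, Vunit v & pi' = v * pi.
  have [a Va aE] : principal_ideal V pi pi' by rewrite -Epi Epi'; exists 1;
    rewrite ?mulr1.
  have [b Vb bE] : principal_ideal V pi' pi by rewrite -Epi' Epi; exists 1;
    rewrite ?mulr1.
  have ab : a * b = 1 by apply: (mulfI pi0); rewrite mulrA aE bE mulr1.
  have a0 : a != 0 by apply: contra_eqN ab => /eqP ->; rewrite mul0r eq_sym oner_eq0.
  exists a; last by rewrite mulrC.
  by split=> //; suff -> : a^-1 = b by []; apply: (mulfI a0); rewrite ab divff.
have VX w k : Vunit w -> Vunit (w ^ k).
  have VXn j : Vunit w -> Vunit (w ^+ j).
    move=> Uw; elim: j => [|j IH]; rewrite ?expr0 ?exprS; last exact: VunitM.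
    by split; rewrite ?oner_eq0 ?invr1.
  by move=> Uw; case: k => j; [apply: VXn | apply/VunitV/VXn].
have E : Vunit (pi ^ (m - n)).
  have : u * pi ^ n = u' * (v ^ m * pi ^ m) by rewrite -xE xE' piE expfzMl.
  move=> E; have -> : pi ^ (m - n) = u / (u' * v ^ m).
    have [v0 _ _] := VX v m Uv.
    rewrite expfzDr // -invr_expz; apply: (mulIf (expfz_neq0 n pi0)).
    by rewrite divfK ?expfz_neq0 // mulrAC E mulrA mulrAC divff ?mul1r // mulf_neq0.
  by apply: VunitM => //; apply: VunitV; apply: VunitM => //; apply: VX.
have notU k : ~ Vunit (pi ^+ k.+1).
  case=> _ _; rewrite exprS invfM => H; apply: Vpi1.
  have -> : pi^-1 = (pi^-1 / pi ^+ k) * pi ^+ k by rewrite divfK ?expf_neq0.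
  by apply: VM => //; apply: VX0.
apply/eqP; rewrite -subr_eq0; move: E; case: (m - n) => [[|k]|k] //.
  by move=> /(notU k).
by move=> /VunitV; rewrite NegzE invr_expz opprK => /(notU k).
Qed.

Lemma ord_decomp : exists2 pi, uniformizer_of pi &
  forall x, x != 0 -> exists2 u, Vunit u & x = u * pi ^ ord P x.
Proof.
have [pi Upi dec] := uniformizer_decomp; exists pi => // x x0.
have [n [u Uu xE]] := dec x x0.
by exists u => //; rewrite (ord_eq Upi Uu xE).
Qed.

Lemma ord_zero : ord P 0 = 0.
Proof.
rewrite /ord; case: xgetP => // n _ [pi [u [Epi _ u0 _ /esym /eqP]]].
have [pi' [pi'0 _ _ Epi'] _] := uniformizer_decomp.
rewrite mulf_eq0 (negPf u0) /= expfz_eq0 => /andP[_ /eqP pi0].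
have : principal_ideal V pi pi' by rewrite -Epi Epi'; exists 1; rewrite ?mulr1.
by case=> y _; rewrite pi0 mul0r => E; move: pi'0; rewrite -E eqxx.
Qed.

Lemma ordM x y : x != 0 -> y != 0 -> ord P (x * y) = ord P x + ord P y.
Proof.
move=> x0 y0; have [pi Upi dec] := ord_decomp.
have [u Uu xE] := dec _ x0; have [v Uv yE] := dec _ y0.
apply: (ord_eq Upi (VunitM Uu Uv)); have [pi0 _ _ _] := Upi.
by rewrite {1}xE {1}yE expfzDr // mulrACA.
Qed.

Lemma Vunit1 : Vunit 1.
Proof. by split; rewrite ?oner_eq0 ?invr1. Qed.

Lemma ord_one : ord P 1 = 0.
Proof.
have [pi Upi _] := ord_decomp.
by apply: (ord_eq Upi Vunit1); rewrite expr0z mulr1.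
Qed.

Lemma ordV x : ord P x^-1 = - ord P x.
Proof.
have [->|x0] := eqVneq x 0; first by rewrite invr0 ord_zero oppr0.
have := ordM x0 (invr_neq0 x0); rewrite divff // ord_one => /esym/eqP.
by rewrite addrC addr_eq0 => /eqP.
Qed.

Lemma ordX x k : ord P (x ^+ k) = ord P x *+ k.
Proof.
have [->|x0] := eqVneq x 0.
  by case: k => [|k]; rewrite ?expr0 ?ord_one // expr0n /= ord_zero mul0rn.
elim: k => [|k IH]; first by rewrite expr0 ord_one mulr0n.
by rewrite exprS ordM ?expf_neq0 // IH mulrS.
Qed.

Lemma val_ringE x : val_ring P x <-> vge P 0 x.
Proof.
rewrite /vge; have [->|x0 /=] := eqVneq x 0; first by split.
have [pi Upi dec] := ord_decomp.
have [pi0 Vpi Vpi1 _] := Upi; have [u [u0 Vu Vu1] ->] := dec _ x0.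
have -> : ord P (u * pi ^ ord P x) = ord P x by apply: (ord_eq Upi) => //.
case: (ord P x) => k; split=> //.
  by move=> _; apply: VM => //; apply: VX0.
rewrite NegzE -invr_expz => H; case: Vpi1.
have -> : pi^-1 = u^-1 * (u * (pi ^+ k.+1)^-1) * pi ^+ k.
  by rewrite mulKf // exprS invfM divfK ?expf_neq0.
by apply: VM; [apply: VM|apply: VX0].
Qed.

Lemma max_idealE x : max_ideal P x <-> vge P 1 x.
Proof.
rewrite /vge; have [->|x0 /=] := eqVneq x 0.
  by split=> // _; case: (max_idealP P) => -[].
have [pi Upi dec] := ord_decomp.
have [pi0 Vpi Vpi1 EM] := Upi.
have ordpi : ord P pi = 1 by apply: (ord_eq Upi Vunit1); rewrite mul1r expr1z.
rewrite EM; split.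
  case=> y /val_ringE; rewrite /vge => Vy yE.
  have y0 : y != 0 by apply: contra_neq x0 => y0; rewrite -yE y0 mulr0.
  move: Vy; rewrite (negPf y0) /= => Vy.
  by rewrite -yE ordM // ordpi lerDl.
move=> xge; exists (x / pi); last by rewrite mulrC divfK.
apply/val_ringE; rewrite /vge ordM ?invr_eq0 // ordV ordpi subr_ge0 xge.
by rewrite orbT.
Qed.

Lemma uniformizer : exists2 pi, pi != 0 & ord P pi = 1.
Proof.
have [pi Upi dec] := ord_decomp.
have [pi0 _ _ _] := Upi; exists pi => //.
by apply: (ord_eq Upi Vunit1); rewrite mul1r expr1z.
Qed.

Lemma vgeE m x : x != 0 -> vge P m x = (m <= ord P x).
Proof. by rewrite /vge => /negPf ->. Qed.

Lemma vge0 m : vge P m 0. Proof. by rewrite /vge eqxx. Qed.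

Lemma vge_le m n x : n <= m -> vge P m x -> vge P n x.
Proof. by rewrite /vge => nm /orP[->//|mx]; rewrite (le_trans nm mx) orbT. Qed.

Lemma vgeM m n x y : vge P m x -> vge P n y -> vge P (m + n) (x * y).
Proof.
rewrite /vge mulf_eq0; have [//|x0 /=] := eqVneq x 0.
have [//|y0 /=] := eqVneq y 0.
by rewrite ordM // => *; apply: lerD.
Qed.

Lemma vgeMr m n x y : y != 0 -> ord P y = n -> vge P (m + n) (x * y) = vge P m x.
Proof.
move=> y0 yn; rewrite /vge mulf_eq0 (negPf y0) orbF.
by have [//|x0 /=] := eqVneq x 0; rewrite ordM // yn lerD2r.
Qed.

(** Shifts level m to level 0, where the condition is membership in the ring [val_ring P]; closure
    under subtraction at every level follows from this. *)
Lemma vge_exprz m pi : pi != 0 -> ord P pi = 1 ->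
  forall x, vge P m x = vge P 0 (x * pi ^ (- m)).
Proof.
move=> pi0 pi1 x; have [->|x0] := eqVneq x 0; first by rewrite mul0r !vge0.
have opi : ord P (pi ^ (- m)) = - m.
  case: m => k; first by rewrite -invr_expz ordV -exprnP ordX pi1 natz.
  by rewrite NegzE opprK -exprnP ordX pi1 natz.
by rewrite -(vgeMr m x (expfz_neq0 (-m) pi0) opi) subrr.
Qed.

Lemma vgeN m x : vge P m (- x) = vge P m x.
Proof.
have H y : vge P m y -> vge P m (- y).
  have [pi pi0 pi1] := uniformizer.
  rewrite !(vge_exprz m pi0 pi1) => /val_ringE Vy; apply/val_ringE.
  by rewrite mulNr -sub0r; apply: VB.
by apply/idP/idP => /H; rewrite ?opprK.
Qed.

Lemma vgeB m x y : vge P m x -> vge P m y -> vge P m (x - y).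
Proof.
have [pi pi0 pi1] := uniformizer.
rewrite !(vge_exprz m pi0 pi1) => /val_ringE Vx /val_ringE Vy; apply/val_ringE.
by rewrite mulrBl; apply: VB.
Qed.

Lemma vgeD m x y : vge P m x -> vge P m y -> vge P m (x + y).
Proof. by move=> mx my; rewrite -(opprK y); apply: vgeB; rewrite ?vgeN. Qed.

Lemma vge_sum m (I : Type) (r : seq I) (p : pred I) (f : I -> F) :
  (forall i, p i -> vge P m (f i)) -> vge P m (\sum_(i <- r | p i) f i).
Proof. by move=> H; elim/big_ind: _ => //; [apply: vge0|apply: vgeD]. Qed.

Lemma vge01 : vge P 0 1.
Proof. by rewrite /vge ord_one lexx orbT. Qed.

Lemma vge11 : ~~ vge P 1 1.
Proof. by rewrite /vge ord_one oner_eq0. Qed.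

Lemma vgeX x k : vge P 0 x -> vge P 0 (x ^+ k).
Proof.
move=> Vx; elim: k => [|k IH]; first exact: vge01.
by rewrite exprS -(addr0 0); apply: vgeM.
Qed.

Lemma vge0M m x y : vge P 0 x -> vge P m y -> vge P m (x * y).
Proof. by move=> Vx my; rewrite -(add0r m); apply: vgeM. Qed.

Lemma ordD_lt x y : x != 0 -> vge P (ord P x + 1) y ->
  x + y != 0 /\ ord P (x + y) = ord P x.
Proof.
move=> x0 Hy.
have Hn : ~~ vge P (ord P x + 1) (x + y).
  apply/negP => H; have := vgeB H Hy.
  by rewrite addrK vgeE // -ltzD1 ltxx.
have xy0 : x + y != 0 by apply: contraNneq Hn => ->; apply: vge0.
split=> //; apply/le_anti; rewrite -(vgeE _ xy0) -ltzD1.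
move: Hn; rewrite vgeE // -ltNge => -> /=.
by apply: vgeD; [rewrite vgeE|apply: vge_le Hy; rewrite lerDl].
Qed.

Lemma ord_cong1 x : vge P 1 (x - 1) -> x != 0 /\ ord P x = 0.
Proof.
move=> x1; have := @ordD_lt 1 (x - 1) (oner_neq0 _).
by rewrite ord_one add0r (addrC 1) subrK; apply.
Qed.

Lemma vge_neg_pole x : ~~ vge P 0 x -> x != 0 /\ ord P x < 0.
Proof. by rewrite /vge negb_or ltNge => /andP[]. Qed.

End Ord.

Lemma prime_eq_ring (F : fieldType) (P Q : prime_of F) :
  val_ring P = val_ring Q -> P = Q.
Proof.
have max_eq : val_ring P = val_ring Q -> max_ideal P = max_ideal Q.
  move=> E; have [_ _ [M [_ _ Mu]]] := val_ring_dvr P.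
  have MP := max_idealP P; have MQ := max_idealP Q.
  by rewrite -E in MQ; rewrite (Mu _ MP) (Mu _ MQ).
case: P Q max_eq => [V M d f m] [V' M' d' f' m'] /= max_eq E.
move: (max_eq E) => E'; subst V' M'.
by rewrite (Prop_irrelevance d d') (Prop_irrelevance f f') (Prop_irrelevance m m').
Qed.

(** * Weak approximation *)

Section Approximation.
Variable F : fieldType.
Implicit Types P Q : prime_of F.

Lemma exists_pole Q : exists x : F, ~~ vge Q 0 x.
Proof.
have [pi pi0 pi1] := uniformizer Q; exists pi^-1.
by rewrite vgeE ?invr_eq0 // ordV pi1.
Qed.

(** A ring strictly above the ring of P contains some x of negative order at P. It then contains
    every y, as the product of x^k and y / x^k with k = |ord y|; but some y has a pole at Q. *)
Lemma dvr_maximal P Q : (forall x, vge P 0 x -> vge Q 0 x) -> P = Q.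
Proof.
move=> PQ; apply: prime_eq_ring; apply/seteqP; split=> x /val_ringE.
  by move=> /PQ /val_ringE.
move=> Qx; apply/val_ringE; apply: contraT => /vge_neg_pole [x0 xlt].
have [y yQ] := exists_pole Q; case/negP: (yQ).
have [y0 yP] : y != 0 /\ ~~ vge P 0 y.
  have yP : ~~ vge P 0 y by apply: contraNN yQ; apply: PQ.
  by have [] := vge_neg_pole yP.
set k := `|ord P y|%N.
have -> : y = x ^+ k * (y / x ^+ k) by rewrite mulrC divfK ?expf_neq0.
apply: vge0M; first exact: vgeX.
apply: PQ; rewrite vgeE ?mulf_neq0 ?invr_neq0 ?expf_neq0 //.
rewrite ordM ?invr_neq0 ?expf_neq0 // ordV ordX /k.
move: xlt; set a := ord P x; set b := ord P y => a0.
rewrite subr_ge0 -mulr_natr natz abszE.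
apply: (@le_trans _ _ (- `|b|)); last by rewrite lerNl -normrN ler_norm.
by rewrite -[leRHS]mulN1r ler_wpM2r // -ltzD1 addNr.
Qed.

Lemma exists_separating P Q : P <> Q -> exists x : F, vge P 1 x /\ ~~ vge Q 0 x.
Proof.
move=> PQ.
have incl P' Q' : P' <> Q' -> exists x, vge P' 0 x /\ ~~ vge Q' 0 x.
  move=> PQ'; apply: contrapT => H; apply: PQ'; apply: dvr_maximal => x Px.
  by apply: contraT => Qx; case: H; exists x.
have [x [xP xQ]] := incl _ _ PQ; have [y [yQ yP]] := incl _ _ (nesym PQ).
have [x0 xltQ] := vge_neg_pole xQ; have [y0 yltP] := vge_neg_pole yP.
exists (x / y); rewrite !vgeE ?mulf_neq0 ?invr_neq0 // !ordM ?invr_neq0 // !ordV.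
move: xP yQ; rewrite !vgeE // => xP yQ; split; last by rewrite -ltNge; lia.
by lia.
Qed.

Lemma exists_separating_seq P (s : seq (prime_of F)) : P \notin s ->
  exists x : F, vge P 1 x /\ forall Q, Q \in s -> ~~ vge Q 0 x.
Proof.
elim: s => [|Q s IH]; first by exists 0; split; [apply: vge0|].
rewrite inE negb_or => /andP[/eqP PQ /IH [z [zP zs]]].
have [zQ|zQ] := boolP (vge Q 0 z); last first.
  by exists z; split=> // Q'; rewrite inE => /orP[/eqP->|/zs].
have [y [yP yQ]] := exists_separating PQ.
(* This m prevents cancellation: where y has a pole, y^(m+1) has a deeper pole than z, and where it
   has none, the pole of z survives in z + y^(m+1). *)
have [m mP] : exists m : nat, forall R, R \in s -> (`|ord R z| < m)%N.
  elim: (s) => [|R s' [m mP]]; first by exists 0%N.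
  exists (maxn m `|ord R z|.+1) => R'; rewrite inE => /orP[/eqP->|/mP].
    by rewrite leq_max leqnn orbT.
  by rewrite leq_max => ->.
have yr R : ~~ vge R 0 y -> y ^+ m.+1 != 0 /\ ord R (y ^+ m.+1) <= - (m.+1)%:Z.
  move=> /vge_neg_pole [y0 ylt]; rewrite expf_neq0 // ordX; split=> //.
  by rewrite -mulr_natr natz -[leRHS]mulN1r ler_wpM2r // -ltzD1 addNr.
exists (z + y ^+ m.+1); split.
  apply: vgeD => //; rewrite exprS -(addr0 1); apply: vgeM => //.
  by apply: vgeX; apply: vge_le yP.
move=> R; rewrite inE => /orP[/eqP->|Rs].
  have [ym0 ymlt] := yr _ yQ.
  apply/negP => /vgeB /(_ zQ); rewrite addrAC subrr add0r vgeE // => H.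
  by have := le_trans H ymlt.
have zR := zs _ Rs; have [z0 zlt] := vge_neg_pole zR.
have [yR|yR] := boolP (vge R 0 y).
  by apply: contraNN zR => /vgeB /(_ (vgeX m.+1 yR)); rewrite addrK.
have [ym0 ymlt] := yr _ yR; apply/negP => H.
have : vge R (- m%:Z) (z + y ^+ m.+1 - z).
  apply: vgeB; first by apply: vge_le H; lia.
  by rewrite vgeE //; have := mP _ Rs; lia.
by rewrite addrAC subrr add0r vgeE // => /le_trans /(_ ymlt); lia.
Qed.

(* The element 1 / (1 + z ^ N) separates P from the other places when z has a
   zero at P and poles at all of them. *)
Lemma exists_idempotent P (s : seq (prime_of F)) (N : nat) : P \notin s ->
  exists e : F, vge P N%:Z (e - 1) /\ forall Q, Q \in s -> vge Q N%:Z e.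
Proof.
move=> /exists_separating_seq [z [zP zs]].
have zNP : vge P N.+1%:Z (z ^+ N.+1).
  have [->|z0] := eqVneq z 0; first by rewrite expr0n vge0.
  rewrite vgeE ?expf_neq0 // ordX -mulr_natr natz.
  by move: zP; rewrite vgeE //; nia.
have [w0 ow] : 1 + z ^+ N.+1 != 0 /\ ord P (1 + z ^+ N.+1) = 0.
  by apply: ord_cong1; rewrite addrAC subrr add0r; apply: vge_le zNP.
exists (1 + z ^+ N.+1)^-1; split.
  have -> : (1 + z ^+ N.+1)^-1 - 1 = - z ^+ N.+1 * (1 + z ^+ N.+1)^-1.
    by apply: (mulIf w0); rewrite mulrBl !mulVf // divfK // mul1r opprD addrA subrr
      sub0r.
  rewrite -(addr0 N%:Z); apply: vgeM; first by rewrite vgeN; apply: vge_le zNP; lia.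
  by rewrite vgeE ?invr_eq0 // ordV ow.
move=> Q /zs zQ; have [z0 zlt] := vge_neg_pole zQ.
have zN0 : z ^+ N.+1 != 0 by rewrite expf_neq0.
have zNlt : ord Q (z ^+ N.+1) <= - N.+1%:Z.
  by rewrite ordX -mulr_natr natz; nia.
have [w1 ow1] : z ^+ N.+1 + 1 != 0 /\ ord Q (z ^+ N.+1 + 1) = ord Q (z ^+ N.+1).
  by apply: ordD_lt => //; apply: vge_le (vge01 Q); lia.
by rewrite addrC vgeE ?invr_eq0 // ordV ow1; lia.
Qed.

Lemma weak_approximation P (s : seq (prime_of F)) (y : F) (N : nat) : P \notin s ->
  exists z : F, vge P N%:Z (z - y) /\ forall Q, Q \in s -> vge Q N%:Z z.
Proof.
have [->|y0] := eqVneq y 0.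
  by move=> _; exists 0; rewrite subrr; split=> *; apply: vge0.
move=> Ps.
(* Multiplication by y loses at most m orders at these places, so the idempotent is taken to
   precision N + m. *)
have [m mP] : exists m : nat, forall R, R \in P :: s -> (`|ord R y| <= m)%N.
  elim: (P :: s) => [|R s' [m mP]]; first by exists 0%N.
  exists (maxn m `|ord R y|) => R'; rewrite inE => /orP[/eqP->|/mP].
    by rewrite leq_max leqnn orbT.
  by rewrite leq_max => ->.
have [e [eP es]] := exists_idempotent (N + m) Ps.
exists (e * y); split.
  have -> : e * y - y = (e - 1) * y by rewrite mulrBl mul1r.
  apply: (@vge_le _ _ ((N + m)%:Z - m%:Z)); first by lia.
  apply: vgeM => //; rewrite vgeE //.
  by have := mP P (mem_head _ _); lia.
move=> Q Qs; apply: (@vge_le _ _ ((N + m)%:Z - m%:Z)); first by lia.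
apply: vgeM; first exact: es.
by rewrite vgeE //; have := mP Q; rewrite inE Qs orbT => /(_ isT); lia.
Qed.

End Approximation.

(** * Valuation rings *)

Definition valuation_ring (F : fieldType) (V : set F) :=
  is_subring V /\ forall u, V u \/ V u^-1.

Section Subring.
Variables (F : fieldType) (V : set F).
Hypothesis Vsub : is_subring V.

Lemma subring1 : V 1. Proof. by case: Vsub. Qed.
Lemma subringB x y : V x -> V y -> V (x - y).
Proof. by case: Vsub => _ H _; apply: H. Qed.
Lemma subringM x y : V x -> V y -> V (x * y).
Proof. by case: Vsub => _ _ H; apply: H. Qed.
Lemma subring0 : V 0.
Proof. by rewrite -(subrr 1); apply: subringB; apply: subring1. Qed.
Lemma subringN x : V x -> V (- x).
Proof. by move=> Vx; rewrite -sub0r; apply: subringB => //; apply: subring0. Qed.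
Lemma subringD x y : V x -> V y -> V (x + y).
Proof. by move=> Vx Vy; rewrite -(opprK y); apply: subringB => //; apply: subringN. Qed.
Lemma subringX x m : V x -> V (x ^+ m).
Proof.
move=> Vx; elim: m => [|m IH]; first exact: subring1.
by rewrite exprS; apply: subringM.
Qed.
Lemma subring_sum (I : Type) (r : seq I) (p : pred I) (f : I -> F) :
  (forall i, p i -> V (f i)) -> V (\sum_(i <- r | p i) f i).
Proof. by move=> H; elim/big_ind: _ => //; [apply: subring0|apply: subringD]. Qed.
Lemma subring_horner (p : {poly F}) u : (forall i, V p`_i) -> V u -> V p.[u].
Proof.
move=> Vp Vu; rewrite horner_coef; apply: subring_sum => i _.
by apply: subringM => //; apply: subringX.
Qed.

Definition coefs_in : set {poly F} := [set p | forall i, V p`_i].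

Lemma coefs_inB p q : coefs_in p -> coefs_in q -> coefs_in (p - q).
Proof. by move=> Vp Vq i; rewrite coefB; apply: subringB. Qed.
Lemma coefs_inD p q : coefs_in p -> coefs_in q -> coefs_in (p + q).
Proof. by move=> Vp Vq i; rewrite coefD; apply: subringD. Qed.
Lemma coefs_inM p q : coefs_in p -> coefs_in q -> coefs_in (p * q).
Proof. by move=> Vp Vq i; rewrite coefM; apply: subring_sum => j _;
  apply: subringM. Qed.
Lemma coefs_inC c : V c -> coefs_in c%:P.
Proof. by move=> Vc i; rewrite coefC; case: ifP => // _; apply: subring0. Qed.
Lemma coefs_inX : coefs_in 'X.
Proof. by move=> i; rewrite coefX; case: eqP => _;
  [apply: subring1|apply: subring0]. Qed.

Lemma adjoin_is_subring (u : F) : is_subring [set p.[u] | p in coefs_in].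
Proof.
split.
- by exists 1; rewrite ?hornerC //; apply: coefs_inC; apply: subring1.
- move=> _ _ [p Vp <-] [q Vq <-]; exists (p - q); first exact: coefs_inB.
  by rewrite hornerD hornerN.
- move=> _ _ [p Vp <-] [q Vq <-]; exists (p * q); first exact: coefs_inM.
  by rewrite hornerM.
Qed.

Lemma localize_is_subring (w : F) : V w -> w != 0 ->
  is_subring [set x | exists m, V (x * w ^+ m)].
Proof.
move=> Vw w0; split.
- by exists 0%N; rewrite expr0 mulr1; apply: subring1.
- move=> x y [i Vx] [j Vy]; exists (i + j)%N; rewrite exprD mulrBl; apply: subringB.
    by rewrite mulrA; apply: subringM => //; apply: subringX.
  by rewrite mulrCA mulrC; apply: subringM => //; apply: subringX.
- move=> x y [i Vx] [j Vy]; exists (i + j)%N; rewrite exprD mulrACA.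
  exact: subringM.
Qed.

End Subring.

(** * Subrings maximal among those that avoid y^-1 are valuation rings *)

Section MaximalSubring.
Variables (F : fieldType) (V : set F) (y : F).
Hypotheses (Vsub : is_subring V) (Vy : V y) (Vy1 : ~ V y^-1).
Hypothesis Vmax : forall B, is_subring B -> ~ B y^-1 -> V `<=` B -> B `<=` V.

(** Every power of w = 1 - y c has the form 1 - y d, so y^-1 w^m in V would put y^-1 in V. Thus the
    localization of V at w still avoids y^-1, and by maximality it is V. *)
Lemma one_sub_unit c : V c -> 1 - y * c != 0 /\ V (1 - y * c)^-1.
Proof.
move=> Vc; set w := 1 - y * c.
have y0 : y != 0 by apply: contra_notN Vy1 => /eqP ->; rewrite invr0; apply: subring0.
have Vw : V w by apply: subringB => //; [apply: subring1|apply: subringM].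
have w0 : w != 0.
  rewrite subr_eq0; apply: contra_notN Vy1 => /eqP E.
  by rewrite -(mulr1 y^-1) E mulKf.
split=> //; apply: (Vmax (localize_is_subring Vsub Vw w0)).
- case=> m Vm; apply: Vy1.
  have [d Vd wE] : exists2 d, V d & w ^+ m = 1 - y * d.
    elim: (m) => [|j [d Vd E]].
      by exists 0; [apply: subring0|rewrite mulr0 subr0].
    exists (c + d * w); first by apply: subringD => //; apply: subringM.
    by rewrite exprSr E /w; ring.
  rewrite -(mulr1 y^-1) -(subrK (y * d) 1) -wE mulrDr mulKf //.
  exact: subringD.
- by move=> x Vx; exists 0%N; rewrite mulr1.
- by exists 1%N; rewrite expr1 mulVf //; apply: subring1.
Qed.

(** A witness of degree at most m that y^-1 lies in V[u]. By maximality every u outside V has one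
    for some m; the degree is recorded for the descent below. *)
Definition inverts u m :=
  exists p : {poly F}, [/\ coefs_in V p, (size p <= m.+1)%N & y * p.[u] = 1].

Lemma inverts0 u : ~ inverts u 0.
Proof.
case=> p [Vp ps E]; apply: Vy1.
have y0 : y != 0 by apply: contra_eqN E => /eqP ->; rewrite mul0r eq_sym oner_eq0.
have -> : y^-1 = p.[u] by apply: (mulfI y0); rewrite E mulfV.
by rewrite (size1_polyC ps) hornerC; apply: Vp.
Qed.

(** Multiplying the relation y r(u^-1) = 1 by u^m expresses (1 - y r_0) u^m through lower powers of
    u. As 1 - y r_0 is a unit of V, the top term of p can be replaced, which lowers its degree. *)
Lemma inverts_step u m l : u != 0 -> (l <= m)%N ->
  inverts u m -> inverts u^-1 l -> inverts u m.-1.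
Proof.
move=> u0 lm [p [Vp ps pE]] [r [Vr rs rE]].
case: m => [|m] in lm ps *; first by case: (@inverts0 u); exists p.
have [w0 Vw] := one_sub_unit (Vr 0%N); set w := 1 - _ in w0 Vw.
pose r' := drop_poly 1 r.
have uE : u ^+ m.+1 = y * w^-1 * \sum_(j < l) r'`_j * u ^+ (m - j).
  have : w = y * (r'.[u^-1] * u^-1).
    have : r.[u^-1] = r`_0 + r'.[u^-1] * u^-1.
      rewrite -[in LHS](poly_take_drop 1 r) hornerD hornerM expr1 hornerX.
      by rewrite /take_poly poly_def big_ord1 expr0 alg_polyC hornerC.
    by move=> E; rewrite /w -[in LHS]rE E; ring.
  rewrite (@horner_coef_wide _ l); last by rewrite size_drop_poly leq_subLR add1n.
  move=> wE; apply: (mulfI w0).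
  rewrite [in RHS]mulrA (mulrC y) mulrA divff // mul1r {1}wE -!mulrA; congr (_ * _).
  rewrite !mulr_suml; apply: eq_bigr => j _; rewrite -!mulrA; congr (_ * _).
  have jm : (j <= m)%N by have := ltn_ord j; lia.
  rewrite -{1}(subnK jm) -addnS [(_ + j.+1)%N]addnC exprD exprVn exprS.
  by have uj := expf_neq0 j u0; field; rewrite u0 uj.
exists (take_poly m.+1 p + \sum_(j < l) (p`_m.+1 * (y * w^-1) * r'`_j) *: 'X^(m - j)).
split.
- apply: coefs_inD => //.
    by move=> i; rewrite coef_take_poly; case: ifP => // _; apply: subring0.
  move=> i; rewrite coef_sum; apply: subring_sum => // j _.
  rewrite coefZ coefXn; apply: subringM => //; last first.
    by case: eqP => _; [apply: subring1|apply: subring0].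
  apply: subringM => //; last by rewrite coef_drop_poly.
  by apply: subringM => //; apply: subringM.
- apply: (leq_trans (size_polyD _ _)); rewrite geq_max size_take_poly /=.
  apply: (leq_trans (size_sum _ _ _)); apply/bigmax_leqP => j _.
  by apply: (leq_trans (size_scale_leq _ _)); rewrite size_polyXn ltnS leq_subr.
- rewrite -pE; congr (_ * _); rewrite -[in RHS](poly_take_drop m.+1 p).
  rewrite !hornerD hornerM hornerXn uE; congr (_ + _).
  have -> : drop_poly m.+1 p = (p`_m.+1)%:P.
    rewrite [LHS]size1_polyC ?coef_drop_poly ?add0n //.
    by rewrite size_drop_poly leq_subLR addn1.
  rewrite hornerC horner_sum !mulr_sumr; apply: eq_bigr => j _.
  by rewrite hornerZ hornerXn; ring.
Qed.

Lemma inverts_both u m l : u != 0 -> inverts u m -> inverts u^-1 l -> False.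
Proof.
(* The larger of the two degrees is lowered, exchanging u and u^-1 if necessary, until one of them
   reaches 0. *)
move: {2}(m + l)%N (leqnn (m + l)) => N; elim: N u m l => [|N IH] u m l.
  by rewrite leqn0 addn_eq0 => /andP[/eqP-> _] _ /inverts0.
move=> mlN u0 Hu Hv.
have [lm|/ltnW ml] := leqP l m.
  case: m => [|m] in mlN lm Hu; first by case: (inverts0 Hu).
  by apply: (IH u m l) => //; apply: (inverts_step u0 lm Hu Hv).
case: l => [|l] in mlN ml Hv; first by case: (inverts0 Hv).
apply: (IH u m l) => //; first by lia.
apply: (@inverts_step u^-1 l.+1 m) => //; first by rewrite invr_eq0.
by rewrite invrK.
Qed.

Lemma maximal_valuation_ring : valuation_ring V.
Proof.
split=> // u; have [->|u0] := eqVneq u 0; first by left; apply: subring0.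
have y0 : y != 0 by apply: contra_notN Vy1 => /eqP ->; rewrite invr0; apply: subring0.
have H v : ~ V v -> exists m, inverts v m.
  move=> Vv; apply: contrapT => Hv; apply: Vv.
  apply: (Vmax (adjoin_is_subring Vsub v)).
  - case=> p Vp E; apply: Hv; exists (size p), p; split=> //.
    by rewrite E divff.
  - by move=> x Vx; exists x%:P; rewrite ?hornerC //; apply: coefs_inC.
  - by exists 'X; rewrite ?hornerX //; apply: coefs_inX.
have [Vu|/H [m Hm]] := pselect (V u); first by left.
have [Vu|/H [l Hl]] := pselect (V u^-1); first by right.
by case: (inverts_both u0 Hm Hl).
Qed.

End MaximalSubring.

Lemma exists_valuation_ring (F : fieldType) (A : set F) (y : F) :
  is_subring A -> A y -> ~ A y^-1 ->
  exists V, [/\ valuation_ring V, A `<=` V & ~ V y^-1].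
Proof.
move=> Asub Ay Ay1.
have [//||V [[Vsub Vy1] AV Vmax]] :=
    @Zorn_above _ (fun B => is_subring B /\ ~ B y^-1) A.
  move=> C [A0 CA0] Ctot Cgood; split; last by case=> B /Cgood[].
  split.
  - by exists A0 => //; case: (Cgood _ CA0) => -[].
  - move=> a b Ua Ub; have [B [CB Ba Bb]] := chain_common Ctot Ua Ub.
    by exists B => //; case: (Cgood _ CB) => Bs _; apply: (subringB Bs).
  - move=> a b Ua Ub; have [B [CB Ba Bb]] := chain_common Ctot Ua Ub.
    by exists B => //; case: (Cgood _ CB) => Bs _; apply: (subringM Bs).
exists V; split=> //; apply: (maximal_valuation_ring Vsub (AV _ Ay) Vy1).
by move=> B Bsub By1; apply: Vmax.
Qed.

(** * Discreteness of a valuation ring whose chains of principal ideals are bounded *)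

Section ValuationRing.
Variables (F : fieldType) (V : set F).
Hypothesis Vval : valuation_ring V.
Let Vsub : is_subring V. Proof. by case: Vval. Qed.
Let Vinv u : V u \/ V u^-1. Proof. by case: Vval => _; apply. Qed.

(** The nonunits of V; zero is listed separately because [0^-1 = 0] lies in V. *)
Definition vmax : set F := [set v | V v /\ (v = 0 \/ ~ V v^-1)].

Lemma vmax_total u : vmax u \/ V u^-1.
Proof.
have [H|H] := pselect (V u^-1); first by right.
by left; split; [case: (Vinv u)|right].
Qed.

Lemma vmaxMl a b : V a -> vmax b -> vmax (a * b).
Proof.
move=> Va [Vb [->|Vb1]]; first by rewrite mulr0; split; [apply: subring0|left].
split; first exact: subringM.
have [->|a0] := eqVneq a 0; first by left; rewrite mul0r.
by right; rewrite invfM => /(subringM Vsub Va); rewrite mulrA divff ?mul1r.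
Qed.

Lemma vmax_unit a : a != 0 -> vmax a -> ~ V a^-1.
Proof. by move=> a0 [_ [/eqP|//]]; rewrite (negPf a0). Qed.

Lemma vmaxD a b : vmax a -> vmax b -> vmax (a + b).
Proof.
suff H c d : V (c / d) -> vmax c -> vmax d -> vmax (c + d).
  have [E|E] := Vinv (a / b); first exact: H.
  by move=> Ha Hb; rewrite addrC; apply: H => //; rewrite -invf_div.
have [->|d0] := eqVneq d 0; first by rewrite addr0.
move=> Vcd _ Hd; have -> : c + d = (c / d + 1) * d by rewrite mulrDl divfK // mul1r.
by apply: vmaxMl => //; apply: subringD => //; apply: subring1.
Qed.

Lemma vmax_ideal : is_ideal V vmax.
Proof.
split; first by move=> x [].
- by split; [apply: subring0|left].
- exact: vmaxD.
- by move=> a x; apply: vmaxMl.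
Qed.

Lemma vmax1 : ~ vmax 1.
Proof. by case=> _ [/eqP|]; rewrite ?oner_eq0 ?invr1 //; case; apply: subring1. Qed.

Lemma vmax_sum (I : Type) (r : seq I) (p : pred I) (f : I -> F) :
  (forall i, p i -> vmax (f i)) -> vmax (\sum_(i <- r | p i) f i).
Proof.
move=> H; elim/big_ind: _ => //; last exact: vmaxD.
by split; [apply: subring0|left].
Qed.

Lemma vmax_is_maximal : is_maximal_ideal V vmax.
Proof.
split; first exact: vmax_ideal.
  by move=> E; apply: vmax1; rewrite E; apply: subring1.
move=> J [JV J0 JD JM] MJ; have [JsubM|] := pselect (J `<=` vmax).
  by left; apply/seteqP.
move=> /existsNP[x /not_implyP[Jx Mx]]; right.
have [//|Vx1] := vmax_total x; apply: ideal_eq_ring => //.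
have x0 : x != 0 by apply: contra_notN Mx => /eqP ->; split; [apply: subring0|left].
by rewrite -(mulVf x0); apply: JM.
Qed.

Lemma vmax_unique M : is_maximal_ideal V M -> M = vmax.
Proof.
move=> [Mid MV Mmax]; have [MV' _ _ MM] := Mid.
have /Mmax : is_ideal V vmax := vmax_ideal.
case=> [x Mx||E]; last 2 first.
- by [].
- by case: vmax1; rewrite E; apply: subring1.
have [//|Vx1] := vmax_total x.
have [->|x0] := eqVneq x 0; first by split; [apply: subring0|left].
case: MV; apply: ideal_eq_ring => //.
by rewrite -(mulVf x0); apply: MM.
Qed.

(** The finiteness condition that replaces noetherianity: the s i generate a strictly decreasing
    chain of principal ideals, all strictly above the one of v, and its length is bounded in terms
    of v. *)
Hypothesis chain_bound : forall v, V v -> v != 0 -> exists N, forall r (s : nat -> F),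
  (forall i, (i < r)%N -> s i != 0 /\ V (s i)) ->
  (forall i j, (i < j < r)%N -> vmax (s j / s i)) ->
  (forall i, (i < r)%N -> vmax (v / s i)) -> (r <= N)%N.
Variable y : F.
Hypotheses (y0 : y != 0) (ymax : vmax y).

Lemma vmax_principal : exists t, [/\ t != 0, vmax t & forall v, vmax v -> V (v / t)].
Proof.
apply: contrapT => H.
have /choice[g Hg] : forall t, exists v, t != 0 -> vmax t ->
    [/\ v != 0, vmax v & vmax (t / v)].
  move=> t; have [->|t0] := eqVneq t 0; first by exists 0.
  have [Mt|] := pselect (vmax t); last by exists 0.
  apply: contrapT => Hv; apply: H; exists t; split=> // v Mv.
  have [->|v0] := eqVneq v 0; first by rewrite mul0r; apply: subring0.
  have [Mtv|] := vmax_total (t / v); last by rewrite invf_div.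
  by case: Hv; exists v.
(* If no element generates the maximal ideal, each of its nonzero elements lies in a strictly larger
   principal ideal inside it; iterating from y gives an infinite ascending chain. *)
pose t i := iter i g y.
have tP i : t i != 0 /\ vmax (t i).
  by elim: i => //= i [ti0 Mti]; have [] := Hg _ ti0 Mti.
have tS i : vmax (t i / t i.+1).
  by have [ti0 Mti] := tP i; have [] := Hg _ ti0 Mti.
have tlt i j : (i < j)%N -> vmax (t i / t j).
  elim: j => // j IH; rewrite ltnS leq_eqVlt => /orP[/eqP->//|/IH Hij].
  have -> : t i / t j.+1 = (t i / t j) * (t j / t j.+1).
    by rewrite mulrA divfK //; case: (tP j).
  by apply: vmaxMl => //; case: Hij.
have [N HN] := chain_bound (proj1 ymax) y0.
suff: (N.+1 <= N)%N by rewrite ltnn.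
(* The chain is read backwards, because [chain_bound] lists its ideals in decreasing order; the
   indices N + 1 down to 1 stay above y = t 0. *)
apply: (HN _ (fun i => t (N.+1 - i)%N)).
- by move=> i _; have [? []] := tP (N.+1 - i)%N.
- by move=> i j /andP[ij jN]; apply: tlt; lia.
- by move=> i iN; apply: (tlt 0%N); lia.
Qed.

Lemma valuation_ring_decomp : exists t, [/\ t != 0, vmax t &
  forall v, V v -> v != 0 -> exists j : nat, exists2 u,
     [/\ u != 0, V u & V u^-1] & v = u * t ^+ j].
Proof.
have [t [t0 Mt tP]] := vmax_principal; exists t; split=> // v Vv v0.
have [N HN] := chain_bound Vv v0.
have [j Vj nVj] : exists2 j, V (v / t ^+ j) & ~ V (v / t ^+ j.+1).
  apply: contrapT => H.
  have Hj j : V (v / t ^+ j).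
    elim: j => [|j IH]; first by rewrite expr0 divr1.
    by apply: contrapT => nV; apply: H; exists j.
  suff: (N.+1 <= N)%N by rewrite ltnn.
  apply: (HN _ (fun i => t ^+ i)).
  - move=> i _; rewrite expf_neq0 //; split=> //.
    by apply: subringX => //; case: Mt.
  - move=> i j /andP[ij _].
    have -> : t ^+ j / t ^+ i = t ^+ (j - i).-1 * t.
      rewrite -exprSr prednK ?subn_gt0 // -{1}(subnK (ltnW ij)) exprD.
      by rewrite mulfK ?expf_neq0.
    by apply: vmaxMl => //; apply: subringX => //; case: Mt.
  - move=> i _; have -> : v / t ^+ i = v / t ^+ i.+1 * t.
      by rewrite exprSr invfM mulrA divfK.
    exact: vmaxMl.
have u0 : v / t ^+ j != 0 by rewrite mulf_neq0 ?invr_eq0 ?expf_neq0.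
exists j, (v / t ^+ j); last by rewrite divfK ?expf_neq0.
split=> //; have [/tP H|//] := vmax_total (v / t ^+ j).
by case: nVj; rewrite exprSr invfM mulrA.
Qed.

Lemma valuation_ring_dvr : is_dvr V.
Proof.
have [t [t0 Mt dec]] := valuation_ring_decomp.
have Vt : V t by case: Mt.
split=> //; last first.
  exists vmax; split; [exact: vmax_is_maximal| |exact: vmax_unique].
  by move=> E; move: ymax y0; rewrite E => ->; rewrite eqxx.
move=> I [IV I0 ID IM].
have [H|] := pselect (forall v, I v -> v = 0).
  exists 0; first exact: subring0.
  apply/seteqP; split=> v; last by case=> w _ <-; rewrite mul0r.
  by move=> /H ->; exists 0; rewrite ?mulr0 //; apply: subring0.
move=> /existsNP[v /not_implyP[Iv /eqP v0]].
have tj w j u : [/\ u != 0, V u & V u^-1] -> w = u * t ^+ j -> I w -> I (t ^+ j).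
  move=> [u0 Vu Vu1] wE Iw; have -> : t ^+ j = u^-1 * w by rewrite wE mulKf.
  exact: IM.
have : exists j, `[< I (t ^+ j) >].
  have [j [u Hu vE]] := dec _ (IV _ Iv) v0; exists j; apply/asboolP.
  exact: (tj v j u).
move=> /ex_minnP[j /asboolP Ij jmin].
exists (t ^+ j); first exact: subringX.
apply/seteqP; split=> w; last by case=> a Va <-; rewrite mulrC; apply: IM.
move=> Iw; have [->|w0] := eqVneq w 0.
  by exists 0; rewrite ?mulr0 //; apply: subring0.
have [i [u Hu wE]] := dec _ (IV _ Iw) w0.
have ji : (j <= i)%N by apply: jmin; apply/asboolP; apply: (tj w i u).
exists (u * t ^+ (i - j)).
  by apply: subringM => //; [case: Hu|apply: subringX].
by rewrite mulrCA -exprD subnKC.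
Qed.

Lemma valuation_ring_frac : has_fraction_field V.
Proof.
move=> x; have [Vx|Vx] := Vinv x.
  by exists x, 1; split=> //; rewrite ?oner_eq0 ?divr1 //; apply: subring1.
have [->|x0] := eqVneq x 0.
  by exists 0, 1; split; rewrite ?oner_eq0 ?mul0r //; [apply: subring0|apply: subring1].
by exists 1, x^-1; split; rewrite ?invr_eq0 ?div1r ?invrK //; apply: subring1.
Qed.

Lemma valuation_ring_prime : exists P : prime_of F, vge P 1 y.
Proof.
exists (PrimeOf valuation_ring_dvr valuation_ring_frac vmax_is_maximal).
exact/max_idealE.
Qed.

End ValuationRing.

(** * Finite extensions of k(T) *)

Lemma bounded_uniq_finite (T : eqType) (A : set T) (N : nat) :
  (forall s, uniq s -> (forall x, x \in s -> A x) -> (size s <= N)%N) ->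
  exists2 s, uniq s & forall x, x \in s <-> A x.
Proof.
move=> H.
pose good m := `[< exists s, [/\ uniq s, forall x, x \in s -> A x & size s = m] >].
have [||m /asboolP[s [us As sm]] mmax] := @ex_maxnP good N.
- by exists 0%N; apply/asboolP; exists [::].
- by move=> m /asboolP[s [us As <-]]; apply: H.
exists s => // x; split; first exact: As.
move=> Ax; apply: contraT => xs.
suff /mmax : good m.+1 by rewrite ltnn.
apply/asboolP; exists (x :: s); split; [by rewrite /= xs| |by rewrite /= sm].
by move=> z; rewrite inE => /orP[/eqP->|/As].
Qed.

(* Take a maximal K-independent family of V modulo M. *)
Lemma exists_basis (F : fieldType) (K V M : set F) (N : nat) :
  is_subring K -> (forall c, K c -> K c^-1) ->
  (forall x y, M x -> M y -> M (x + y)) -> (forall c x, K c -> M x -> M (c * x)) ->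
  (forall d (e : 'I_d -> F), (forall i, V (e i)) ->
     (forall c : 'I_d -> F, (forall i, K (c i)) -> M (\sum_i c i * e i) ->
        forall i, c i = 0) -> (d <= N)%N) ->
  exists d (e : 'I_d -> F), [/\ forall i, V (e i),
    forall x, V x -> exists c : 'I_d -> F,
      (forall i, K (c i)) /\ M (x - \sum_i c i * e i) &
    forall c : 'I_d -> F, (forall i, K (c i)) -> M (\sum_i c i * e i) ->
      forall i, c i = 0].
Proof.
move=> Ksub KV MD KM bound.
pose free d (e : 'I_d -> F) := (forall i, V (e i)) /\
  forall c : 'I_d -> F, (forall i, K (c i)) -> M (\sum_i c i * e i) ->
     forall i, c i = 0.
have [||d /asboolP[e [eV efree]] dmax] := @ex_maxnP (fun d => `[< exists e, @free d e
  >]) N.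
- by exists 0%N; apply/asboolP; exists (fun=> 0); split=> [[]|c _ _ []].
- by move=> d /asboolP[e [eV efree]]; apply: bound efree.
exists d, e; split=> // x Vx; apply: contrapT => Hx.
suff /dmax : `[< exists e, @free d.+1 e >] by rewrite ltnn.
apply/asboolP; exists (fun i => if unlift ord0 i is Some j then e j else x).
split=> [i|c cK]; first by case: unliftP.
rewrite big_ord_recl unlift_none.
under eq_bigr do rewrite liftK.
move=> Mc; have c0 : c ord0 = 0.
  apply/eqP; apply: contraT => c0; case: Hx.
  exists (fun j => - ((c ord0)^-1 * c (fintype.lift ord0 j))); split.
    by move=> j; apply: subringN => //; apply: subringM => //; apply: KV.
  have -> : x - \sum_i - ((c ord0)^-1 * c (fintype.lift ord0 i)) * e i
      = (c ord0)^-1 * (c ord0 * x + \sum_i c (fintype.lift ord0 i) * e i).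
    rewrite mulrDr mulKf //; congr (_ + _); rewrite mulr_sumr -sumrN.
    by apply: eq_bigr => j _; rewrite mulNr opprK mulrA.
  by apply: KM => //; apply: KV.
rewrite c0 mul0r add0r in Mc.
by move=> i; case: (unliftP ord0 i) => [j|] -> //;
  apply: (efree (fun j => c (fintype.lift ord0 j))).
Qed.

Lemma fiber_large (A B : finType) (S : {set A}) (f : A -> B) (M : nat) :
  (M * #|B| < #|S|)%N -> exists b, (M < #|[set x in S | f x == b]|)%N.
Proof.
move=> H; apply: contrapT => Hb; move: H; rewrite ltnNge; case/negP.
rewrite -sum1_card (partition_big f xpredT) //= mulnC -sum_nat_const.
apply: leq_sum => b _; rewrite leqNgt; apply: contra_notN Hb => H; exists b.
apply: (leq_trans H); rewrite -sum1_card leq_eqVlt; apply/orP; left; apply/eqP.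
by apply: eq_bigl => x; rewrite inE.
Qed.

Lemma big_supp (T : eqType) (R : zmodType) (s1 s2 : seq T) (f : T -> R) :
  uniq s1 -> uniq s2 -> (forall x, f x != 0 -> x \in s1) ->
  (forall x, f x != 0 -> x \in s2) ->
  \sum_(x <- s1) f x = \sum_(x <- s2) f x.
Proof.
move=> u1 u2 H1 H2.
have H s : uniq s -> \sum_(x <- s) f x = \sum_(x <- [seq x <- s | f x != 0]) f x.
  move=> us; rewrite big_filter [LHS](bigID (fun x => f x != 0)) /= [X in _ + X]big1
    ?addr0 //.
  by move=> x /negPn/eqP.
rewrite H // [RHS]H //; apply: perm_big; apply: uniq_perm; rewrite ?filter_uniq //.
move=> x; rewrite !mem_filter; have [//|fx /=] := eqVneq (f x) 0.
by rewrite H1 // H2.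
Qed.

(** * The counting bound and the places of a finite extension of k(T) *)

Section FunctionField.
Variables (F : fieldType) (k : finFieldType) (al : {rmorphism {poly k} -> F}).
Variables (n : nat) (om : 'I_n -> F).
Hypothesis al_inj : injective al.
(** [om] is a basis over k(T), with freeness and spanning expressed by polynomial coefficients after
    clearing denominators. T itself is [al 'X]. *)
Hypothesis om_free : forall p : 'I_n -> {poly k},
  \sum_i al (p i) * om i = 0 -> forall i, p i = 0.
Hypothesis om_span : forall z : F, exists g, exists2 p : 'I_n -> {poly k},
  g != 0 & al g * z = \sum_i al (p i) * om i.

Definition cstp (c : k) : F := al c%:P.

HB.instance Definition _ := GRing.RMorphism.copy cstp (al \o polyC).

Definition evx (x : F) (phi : {poly k}) : F := (map_poly cstp phi).[x].

Definition poly_free (x : F) (I : finType) (z : I -> F) :=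
  forall phi : I -> {poly k},
    \sum_i evx x (phi i) * z i = 0 -> forall i, phi i = 0.

Lemma al_neq0 g : g != 0 -> al g != 0.
Proof. by apply: contraNneq => H; apply/eqP/al_inj; rewrite H rmorph0. Qed.

Lemma common_denominator (I : finType) (z : I -> F) :
  exists g, exists2 p : I -> 'I_n -> {poly k},
    g != 0 & forall i, al g * z i = \sum_j al (p i j) * om j.
Proof.
have /choice[gp Hgp] : forall i, exists gp : {poly k} * ('I_n -> {poly k}),
    gp.1 != 0 /\ al gp.1 * z i = \sum_j al (gp.2 j) * om j.
  by move=> i; have [g [p g0 E]] := om_span (z i); exists (g, p).
exists (\prod_i (gp i).1).
exists (fun i j => \prod_(i' | i' != i) (gp i').1 * (gp i).2 j).
  by apply/prodf_neq0 => i _; case: (Hgp i).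
move=> i; rewrite (bigD1 i) //= mulrC rmorphM mulrA [z i * _]mulrC.
rewrite (Hgp i).2 mulr_suml; apply: eq_bigr => j _.
by rewrite rmorphM; ring.
Qed.

Lemma evxE x (m : nat) (c : nat -> k) :
  evx x (\poly_(s < m) c s) = \sum_(s < m) cstp (c s) * x ^+ s.
Proof.
rewrite /evx poly_def rmorph_sum /= horner_sum; apply: eq_bigr => s _.
by rewrite linearZ /= map_polyXn hornerZ hornerXn.
Qed.

Lemma evxB x p q : evx x (p - q) = evx x p - evx x q.
Proof. by rewrite /evx rmorphB /= hornerD hornerN. Qed.

(* Counting: the elements \sum_i \sum_(s < M) c_is x^s z_i are pairwise distinct,
   and after clearing denominators their coordinates in the basis om are
   polynomials of size at most d M + O(1); let M tend to infinity. *)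
Lemma poly_free_card (a b : {poly k}) (d : nat) (I : finType) (z : I -> F) :
  b != 0 -> (size a <= d.+1)%N -> (size b <= d.+1)%N ->
  poly_free (al a / al b) z -> (#|I| <= n * d)%N.
Proof.
move=> b0 da db zfree; set x := al a / al b in zfree *.
have alb0 : al b != 0 by apply: al_neq0.
have [g [p g0 gz]] := common_denominator z.
pose h := (\max_i \max_j size (p i j))%N.
have hP i j : (size (p i j) <= h)%N.
  by rewrite /h (bigmaxD1 i) // leq_max (bigmaxD1 j) // leq_max leqnn.
rewrite leqNgt; apply/negP => Icard.
(* If #|I| is at least n d + 1, the #|I| M coefficients outnumber the n N = n h + n d M coordinates
   as soon as M > n h. *)
pose M := (n * h).+1; pose N := (h + d * M)%N.
pose phi (c : {ffun I * 'I_M -> k}) i : {poly k} :=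
  \poly_(s < M) c (i, inord s).
pose q (c : {ffun I * 'I_M -> k}) j : {poly k} :=
  \sum_i \sum_(s < M) c (i, s) *: (a ^+ s * b ^+ (M - s) * p i j).
have qE c : al g * al b ^+ M * (\sum_i evx x (phi c i) * z i)
            = \sum_j al (q c j) * om j.
  rewrite /q mulr_sumr; under [RHS]eq_bigr do rewrite rmorph_sum mulr_suml.
  rewrite [RHS]exchange_big; apply: eq_bigr => i _ /=.
  rewrite evxE mulr_suml mulr_sumr.
  under [RHS]eq_bigr do rewrite rmorph_sum mulr_suml.
  rewrite [RHS]exchange_big; apply: eq_bigr => s _ /=.
  rewrite inord_val.
  transitivity (al b ^+ M * (cstp (c (i, s)) * x ^+ s) * (al g * z i)); first by ring.
  rewrite gz mulr_sumr; apply: eq_bigr => j _.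
  rewrite -mul_polyC !rmorphM !rmorphXn /= mulrA; congr (_ * _).
  rewrite -/(cstp _) /x -{1}(subnK (ltnW (ltn_ord s))) exprD expr_div_n.
  have := expf_neq0 s alb0; move: (al b ^+ s) (al b ^+ (M - s)) => B B' B0.
  by field.
have qsize c j : (size (q c j) <= N)%N.
  apply: (leq_trans (size_sum _ _ _)); apply/bigmax_leqP => i _.
  apply: (leq_trans (size_sum _ _ _)); apply/bigmax_leqP => s _.
  apply: (leq_trans (size_scale_leq _ _)); apply: (leq_trans (size_polyMleq _ _)).
  have sa := size_poly_exp_leq a s; have sb := size_poly_exp_leq b (M - s).
  have sab := size_polyMleq (a ^+ s) (b ^+ (M - s)).
  have := hP i j; have := ltn_ord s; rewrite /N.
  move: (size a) (size b) (size (p i j)) (size (a ^+ s)) (size (b ^+ (M - s))) (size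
    (a ^+ s * b ^+ (M - s))) da db sa sb sab => u1 u2 u3 u4 u5 u6.
  by nia.
pose Q (c : {ffun I * 'I_M -> k}) : {ffun 'I_n * 'I_N -> k} :=
  [ffun jl : 'I_n * 'I_N => (q c jl.1)`_jl.2].
have Qinj : injective Q.
  move=> c c' /ffunP E.
  have qq j : q c j = q c' j.
    apply/polyP => l; have [lN|Nl] := ltnP l N; last first.
      by rewrite !nth_default // (leq_trans _ Nl).
    by have := E (j, Ordinal lN); rewrite !ffunE.
  have S0 : \sum_i evx x (phi c i - phi c' i) * z i = 0.
    have := congr2 (fun u v => u - v) (qE c) (qE c').
    rewrite /= (eq_bigr _ (fun j _ => congr1 (fun u => al u * om j) (qq j))).
    rewrite subrr -mulrBr => /eqP; rewrite !mulf_eq0 (negPf (al_neq0 g0)).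
    rewrite (negPf (expf_neq0 _ alb0)) /= -sumrB => /eqP S0.
    rewrite -[RHS]S0.
    by apply: eq_bigr => i _; rewrite evxB mulrBl.
  apply/ffunP => -[i s]; have := zfree _ S0 i => /eqP.
  rewrite subr_eq0 => /eqP /(congr1 (fun u : {poly k} => u`_s)).
  by rewrite !coef_poly ltn_ord inord_val.
have := leq_card _ Qinj; rewrite !card_ffun !card_prod !card_ord.
have k1 : (1 < #|k|)%N by apply: card_finNzRing_gt1.
by rewrite leq_exp2l //; rewrite /N /M; nia.
Qed.

Lemma evx_drop x (phi : {poly k}) :
  evx x phi = cstp phi`_0 + x * evx x (drop_poly 1 phi).
Proof.
rewrite -{1}(poly_take_drop 1 phi) /evx rmorphD rmorphM /= map_polyXn expr1.
rewrite hornerD hornerM hornerX mulrC; congr (_ + _).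
by rewrite /take_poly poly_def big_ord1 expr0 alg_polyC map_polyC hornerC.
Qed.

Lemma evxN x p : evx x (- p) = - evx x p.
Proof. by rewrite /evx rmorphN hornerN. Qed.

(* A nontrivial relation over k[x], divided by the largest possible power of x,
   is nontrivial modulo x. *)
Lemma poly_free_local (x : F) (I : finType) (z : I -> F) : x != 0 ->
  (forall (c : I -> k) (phi : I -> {poly k}),
     \sum_i cstp (c i) * z i = x * \sum_i evx x (phi i) * z i ->
     forall i, c i = 0) ->
  poly_free x z.
Proof.
move=> x0 H phi.
have [m Hm] : exists m, forall i, (size (phi i) <= m)%N.
  by exists (\max_i size (phi i)) => i; rewrite (bigmaxD1 i) // leq_max leqnn.
elim: m phi Hm => [|m IH] phi Hm S0 i.
  by apply/eqP; rewrite -size_poly_eq0 -leqn0.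
have c0 : forall i, (phi i)`_0 = 0.
  apply: (H _ (fun i => - drop_poly 1 (phi i))); apply/eqP.
  rewrite -subr_eq0 -[X in _ == X]S0 mulr_sumr -sumrB; apply/eqP.
  by apply: eq_bigr => j _; rewrite evxN (evx_drop x (phi j)); ring.
have d0 : drop_poly 1 (phi i) = 0.
  apply: (IH (fun i => drop_poly 1 (phi i))) => [j|].
    by rewrite size_drop_poly leq_subLR add1n.
  apply: (mulfI x0); rewrite mulr0 -[RHS]S0 mulr_sumr; apply: eq_bigr => j _.
  by rewrite (evx_drop x (phi j)) c0 rmorph0 add0r mulrA.
rewrite -(poly_take_drop 1 (phi i)) d0 mul0r addr0.
by rewrite /take_poly poly_def big_ord1 c0 scale0r.
Qed.

(** The equation c^|k| = c makes the order equal to |k| times itself. *)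
Lemma ord_cst (P : prime_of F) c : ord P (cstp c) = 0.
Proof.
have : cstp c ^+ #|k| = cstp c by rewrite -rmorphXn /= expf_card.
move=> /(congr1 (ord P)); rewrite ordX -mulr_natr natz => /eqP.
have k1 : (1 < #|k|)%N by apply: card_finNzRing_gt1.
by rewrite -subr_eq0 -{2}(mulr1 (ord P _)) -mulrBr mulf_eq0 => /orP[/eqP|/eqP]; lia.
Qed.

Lemma vge_cst (P : prime_of F) c : vge P 0 (cstp c).
Proof. by rewrite /vge ord_cst lexx orbT. Qed.

Lemma vge_evx (P : prime_of F) x phi : vge P 0 x -> vge P 0 (evx x phi).
Proof.
move=> Vx; rewrite -[phi]coefK evxE; apply: vge_sum => i _.
by apply: vge0M; [apply: vge_cst|apply: vgeX].
Qed.

(** Independence in the residue field over k, not over the full field of constants;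
    [exists_residue_basis] relates the two. *)
Definition residue_free (P : prime_of F) (J : finType) (u : J -> F) :=
  (forall j, vge P 0 (u j)) /\
  forall c : J -> k, vge P 1 (\sum_j cstp (c j) * u j) -> forall j, c j = 0.

(** In a t-adic expansion whose digits are combinations of the u a, the lowest nonzero digit
    determines the order. So an order of at least e kills the digits one after the other. *)
Lemma residue_free_powers (P : prime_of F) (J : finType) (u : J -> F) (t : F)
    (e : nat) (c : 'I_e -> J -> k) :
  residue_free P u -> t != 0 -> ord P t = 1 ->
  vge P e%:Z (\sum_j \sum_a cstp (c j a) * (t ^+ j * u a)) ->
  forall j a, c j a = 0.
Proof.
move=> [uV ufree] t0 t1 He.
suff H m : (m <= e)%N -> forall j : 'I_e, (j < m)%N -> forall a, c j a = 0.
  by move=> j; apply: (H e).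
elim: m => // m IH me j; rewrite ltnS leq_eqVlt => /orP[/eqP jm|]; last first.
  by apply: IH; apply: ltnW.
apply: ufree; rewrite -(vgeMr 1 _ (expf_neq0 m t0) (n := m%:Z)); last first.
  by rewrite ordX t1 natz.
move: He; rewrite (bigD1 j) //= => He.
have -> : (\sum_a cstp (c j a) * u a) * t ^+ m = \sum_a cstp (c j a) * (t ^+ j * u a).
  by rewrite mulr_suml; apply: eq_bigr => a _; rewrite jm; ring.
set S := \sum_a _ in He *; set S' := \sum_(i | _) _ in He.
rewrite -(addrK S' S); apply: vgeB; first by apply: vge_le He; lia.
apply: vge_sum => i ij; apply: vge_sum => a _.
have [im|im] := ltnP i m; first by rewrite IH ?rmorph0 ?mul0r ?vge0 // ltnW.
apply: vge0M; first exact: vge_cst.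
rewrite -(addr0 (1 + _)); apply: vgeM => //.
rewrite vgeE ?expf_neq0 // ordX t1 natz.
have : i != m :> nat by rewrite -jm.
by lia.
Qed.

(* The inequality \sum e f <= n, by approximating the t^j u_a at each place of s.
   As s and the families u are arbitrary finite ones, it also bounds the number
   of zeros of x and the dimensions of the residue fields. *)
Lemma sum_ord_le (a b : {poly k}) (d : nat) (s : seq (prime_of F))
    (e : prime_of F -> nat) (J : prime_of F -> finType)
    (u : forall P, J P -> F) :
  a != 0 -> b != 0 -> (size a <= d.+1)%N -> (size b <= d.+1)%N -> uniq s ->
  (forall P, P \in s -> residue_free P (u P)) ->
  (forall P, P \in s -> (e P)%:Z <= ord P (al a / al b)) ->
  (\sum_(P <- s) e P * #|J P| <= n * d)%N.
Proof.
move=> a0 b0 da db us ufree eP; set x := al a / al b in eP.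
have x0 : x != 0 by rewrite mulf_neq0 ?invr_eq0 ?al_neq0.
pose Pi (i : 'I_(size s)) := tnth (in_tuple s) i.
have Pis i : Pi i \in s by apply: mem_tnth.
have Pi_inj : injective Pi by apply/tuple_uniqP.
pose K := {i : 'I_(size s) & ('I_(e (Pi i)) * J (Pi i))%type}.
have /choice[t Ht] : forall P : prime_of F, exists t, t != 0 /\ ord P t = 1.
  by move=> P; have [t t0 t1] := uniformizer P; exists t.
pose y (kk : K) := t (Pi (tag kk)) ^+ (tagged kk).1 * u _ (tagged kk).2.
pose N := (\max_(P <- s) e P)%N.
have eN P : P \in s -> (e P <= N)%N by move=> Ps; rewrite /N (big_rem P) //= leq_maxl.
have /choice[z Hz] : forall kk : K, exists z,
    vge (Pi (tag kk)) N%:Z (z - y kk) /\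
    forall i, i != tag kk -> vge (Pi i) N%:Z z.
  move=> kk; have : Pi (tag kk) \notin rem (Pi (tag kk)) s by rewrite mem_rem_uniqF.
  move=> /(weak_approximation (y kk) N) [z [zP zs]]; exists z; split=> // i ik.
  by apply: zs; rewrite mem_rem_uniq // !inE (inj_eq Pi_inj) ik Pis.
have yV kk : vge (Pi (tag kk)) 0 (y kk).
  apply: vge0M; last by case: (ufree _ (Pis (tag kk))).
  by apply: vgeX; rewrite vgeE ?(Ht _).1 // (Ht _).2.
have zV i kk : vge (Pi i) 0 (z kk).
  have [->|ik] := eqVneq i (tag kk); last first.
    by apply: vge_le (proj2 (Hz kk) _ ik).
  by rewrite -(subrK (y kk) (z kk)); apply: vgeD => //; apply: vge_le (Hz kk).1.
suff : (#|{: K}| <= n * d)%N.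
  rewrite card_tagged sumnE big_map big_enum /=.
  under eq_bigr do rewrite card_prod card_ord.
  by rewrite [X in _ -> (X <= _)%N](big_tnth _ _ s).
apply: (poly_free_card (z := z) b0 da db).
(* The relation is read at the place [Pi i]. There its right side has order at least e, the z
   attached to other places vanish to order e, and those attached to [Pi i] may be replaced by the
   t^j u_a they approximate. *)
apply: poly_free_local => // c phi E [i [j w]].
apply: (@residue_free_powers (Pi i) _ (u (Pi i)) (t (Pi i)) (e (Pi i))
         (fun j w => c (Tagged _ (j, w)))); try exact: (Ht _).1; try exact: (Ht _).2.
  exact: ufree.
have HE : vge (Pi i) (e (Pi i))%:Z (\sum_kk cstp (c kk) * z kk).
  rewrite E -(addr0 (e _)%:Z); apply: vgeM; first by rewrite vgeE // eP.
  apply: vge_sum => kk _; apply: vge0M; last exact: zV.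
  by apply: vge_evx; rewrite vgeE //; apply: le_trans (eP _ (Pis i)).
have eNi : (e (Pi i))%:Z <= N%:Z by rewrite lez_nat eN.
pose tg i (jw : 'I_(e (Pi i)) * J (Pi i)) : K := existT _ i jw.
have SE : \sum_kk cstp (c kk) * z kk = \sum_i \sum_jw cstp (c (tg i jw)) * z (tg i jw).
  by rewrite sig_big_dep; apply: eq_bigr => -[].
move: HE; rewrite SE (bigD1 i) //=; set S1 := \sum_jw _; set S2 := \sum_(_ | _) _.
move=> HE; rewrite pair_big /=; set S3 := \sum_p _.
have -> : S3 = (S1 + S2) - S2 - (S1 - S3) by ring.
apply: vgeB; first apply: vgeB => //.
  apply: vge_sum => i' ii'; apply: vge_sum => jw _; apply: vge0M; first exact: vge_cst.
  by apply: (vge_le eNi); apply: (Hz (tg i' jw)).2; rewrite eq_sym.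
rewrite /S1 /S3 -sumrB; apply: vge_sum => -[j' w'] _ /=.
rewrite -mulrBr; apply: vge0M; first exact: vge_cst.
by apply: (vge_le eNi); apply: (Hz (tg i (j', w'))).1.
Qed.

Lemma n_gt0 : (0 < n)%N.
Proof.
rewrite lt0n; apply/eqP => n0; have [g [p g0]] := om_span 1.
rewrite big1 => [|[i im]]; last by exfalso; rewrite n0 in im.
by rewrite mulr1 => /eqP; rewrite (negPf (al_neq0 g0)).
Qed.

Lemma evx_X phi : evx (al 'X) phi = al phi.
Proof.
rewrite -[phi]coefK evxE poly_def rmorph_sum; apply: eq_bigr => i _.
by rewrite -mul_polyC rmorphM rmorphXn.
Qed.

(** The n + 1 first powers of z are too many to be free over k[T]: this is the counting bound for x
    = T / 1 and d = 1. *)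
Lemma algebraic_over_poly z :
  exists2 Phi : {poly {poly k}}, Phi != 0 & (map_poly al Phi).[z] = 0.
Proof.
apply: contrapT => H.
suff : (#|'I_n.+1| <= n * 1)%N by rewrite card_ord muln1 ltnn.
apply: (@poly_free_card 'X 1 1 _ (fun i : 'I_n.+1 => z ^+ i)).
- exact: oner_neq0.
- by rewrite size_polyX.
- by rewrite size_poly1.
move=> phi; rewrite rmorph1 divr1; under eq_bigr do rewrite evx_X.
move=> S0 i.
pose Phi : {poly {poly k}} := \poly_(i < n.+1) phi (inord i).
have Phi0 : Phi = 0.
  apply/eqP; apply: contraT => Phi0; case: H; exists Phi => //.
  rewrite -[RHS]S0 /Phi poly_def rmorph_sum horner_sum; apply: eq_bigr => j _ /=.
  by rewrite -mul_polyC rmorphM /= map_polyC map_polyXn hornerM hornerC hornerXn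
    inord_val.
by move: (congr1 (fun p : {poly {poly k}} => p`_i) Phi0);
  rewrite coef_poly ltn_ord inord_val coef0.
Qed.

Lemma algebraic_over_poly_neq0 z : z != 0 ->
  exists2 Phi : {poly {poly k}}, Phi`_0 != 0 & (map_poly al Phi).[z] = 0.
Proof.
move=> z0; have [Phi] := algebraic_over_poly z.
move: {2}(size Phi) (leqnn (size Phi)) => m.
elim: m Phi => [|m IH] Phi Phim Phi0 E.
  by move: Phi0; rewrite -size_poly_eq0 -leqn0 Phim.
have [c0|] := eqVneq Phi`_0 0; last by exists Phi.
have PhiE : Phi = drop_poly 1 Phi * 'X.
  rewrite -{1}(poly_take_drop 1 Phi) expr1 /take_poly poly_def big_ord1 c0.
  by rewrite scale0r add0r.
apply: (IH (drop_poly 1 Phi)).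
- by rewrite size_drop_poly leq_subLR add1n.
- by apply: contraNneq Phi0 => d0; rewrite PhiE d0 mul0r.
- apply/eqP; move: E; rewrite {1}PhiE rmorphM /= map_polyX hornerM hornerX.
  by move=> /eqP; rewrite mulf_eq0 (negPf z0) orbF.
Qed.

Lemma valuation_ring_cst (V : set F) c : valuation_ring V -> V (cstp c).
Proof.
move=> [Vsub Vinv]; have [->|c0] := eqVneq c 0; first by rewrite rmorph0;
  apply: subring0.
have ck := expf_card c; have k1 : (1 < #|k|)%N by apply: card_finNzRing_gt1.
have [//|Vc1] := Vinv (cstp c).
(* A nonzero c satisfies c^(|k| - 1) = 1, so it is a power of its inverse. *)
suff -> : cstp c = (cstp c)^-1 ^+ (#|k| - 2) by apply: subringX.
rewrite -fmorphV -rmorphXn; congr cstp; rewrite exprVn.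
apply: (mulIf (expf_neq0 (#|k| - 2) c0)); rewrite mulVf ?expf_neq0 //.
by apply: (mulfI c0); rewrite mulr1 -[RHS]ck -{2}(subnKC k1) exprD expr2 mulrA.
Qed.

Lemma valuation_ring_val (P : prime_of F) : valuation_ring (val_ring P).
Proof.
split; first by case: (val_ring_dvr P).
move=> u; have [->|u0] := eqVneq u 0; first by left; apply/val_ringE; apply: vge0.
have [uP|uP] := lerP 0 (ord P u); first by left; apply/val_ringE; rewrite vgeE.
by right; apply/val_ringE; rewrite vgeE ?invr_eq0 // ordV; lia.
Qed.

Lemma valuation_ring_evx (V : set F) x phi : valuation_ring V -> V x -> V (evx x phi).
Proof.
move=> Vval Vx; have [Vsub _] := Vval.
rewrite -[phi]coefK evxE; apply: subring_sum => // i _.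
by apply: subringM => //; [apply: valuation_ring_cst|apply: subringX].
Qed.

(* Here [a] is the nonzero constant coefficient of an equation of z over k[T],
   and [D] bounds the degrees of the others, so that a / T^D works when T has
   a pole. *)
Lemma dominated z : z != 0 -> exists a D, a != 0 /\
  forall V, valuation_ring V -> V z ->
    (V (al 'X) -> V (al a / z)) /\ (~ V (al 'X) -> V (al a / al 'X^D / z)).
Proof.
move=> z0; have [Phi Phi0 E] := algebraic_over_poly_neq0 z0.
pose Psi := drop_poly 1 Phi.
exists Phi`_0, (\max_(i < size Psi) size (Psi`_i)%R)%N; split=> // V Vval Vz.
have [Vsub Vinv] := Vval.
have {E} E : al Phi`_0 / z = - (map_poly al Psi).[z].
  apply: (mulIf z0); rewrite divfK //; apply/eqP;
    rewrite mulNr -addr_eq0 -[X in _ == X]E.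
  rewrite -[in X in _ == X](poly_take_drop 1 Phi) rmorphD rmorphM /= expr1 map_polyX.
  rewrite hornerD hornerM hornerX -/Psi; apply/eqP; congr (_ + _).
  by rewrite /take_poly poly_def big_ord1 expr0 alg_polyC map_polyC hornerC.
split=> [VX|VX].
  rewrite E; apply: subringN => //; apply: subring_horner => // i.
  by rewrite coef_map /= -evx_X; apply: valuation_ring_evx.
have {}VX : V (al 'X)^-1 by case: (Vinv (al 'X)).
set D := (\max_(i < _) _)%N.
rewrite mulrAC E mulNr; apply: subringN => //.
rewrite horner_coef mulr_suml; apply: subring_sum => // i _.
rewrite mulrAC; apply: subringM => //; last exact: subringX.
rewrite coef_map /= -[Psi`_i]coefK poly_def rmorph_sum mulr_suml.
apply: subring_sum => // j _.
rewrite -mul_polyC rmorphM -mulrA; apply: subringM => //.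
  exact: valuation_ring_cst.
have jD : (j <= D)%N.
  have iPsi : (i < size Psi)%N by apply: leq_trans (ltn_ord i) (size_poly _ _).
  apply: (leq_trans (ltnW (ltn_ord j))).
  by rewrite /D (bigmaxD1 (Ordinal iPsi)) // leq_max leqnn.
have X0 : al 'X != 0 by apply: al_neq0; rewrite polyX_eq0.
rewrite -(subnK jD) exprD rmorphM /= !rmorphXn invfM mulrCA divff ?mulr1 ?expf_neq0 //.
by rewrite -exprVn; apply: subringX.
Qed.

(** The counterpart of [residue_free_powers] when V is not known to be discrete. In a relation
    modulo x, the nonzero term of least index dominates all others, which would put its coefficient,
    a unit, into the maximal ideal. *)
Lemma chain_poly_free (V : set F) (x : F) r (s : nat -> F) :
  valuation_ring V -> x != 0 ->
  (forall i, (i < r)%N -> s i != 0 /\ V (s i)) ->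
  (forall i j, (i < j < r)%N -> vmax V (s j / s i)) ->
  (forall i, (i < r)%N -> vmax V (x / s i)) ->
  poly_free x (fun i : 'I_r => s i).
Proof.
move=> Vval x0 sV smax xmax; have [Vsub _] := Vval.
apply: poly_free_local => // c phi E i0; apply/eqP; apply: contraT => ci0.
case: (@arg_minnP _ i0 (fun i => c i != 0) (fun i => i : nat)) => // i ci imin.
have [si0 Vsi] := sV i (ltn_ord i).
have Vx : V x.
  by rewrite -(divfK si0 x); apply: subringM => //; case: (xmax i (ltn_ord i)).
have : vmax V (cstp (c i)).
  have -> : cstp (c i) = (x / s i) * \sum_j evx x (phi j) * s j
      - \sum_(j | j != i) cstp (c j) * (s j / s i).
    rewrite mulrAC -E (bigD1 i) //= mulrDl mulfK // mulr_suml.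
    apply/eqP; rewrite eq_sym subr_eq; apply/eqP; congr (_ + _).
    by apply: eq_bigr => j _; rewrite mulrA.
  apply: vmaxD => //.
    rewrite mulrC; apply: vmaxMl => //; last exact: xmax.
    apply: subring_sum => // j _; apply: subringM => //;
      last by case: (sV j (ltn_ord j)).
    exact: valuation_ring_evx.
  rewrite -mulN1r; apply: vmaxMl => //; first by apply: subringN => //; apply: subring1.
  apply: vmax_sum => // j ji; have [cj|cj] := eqVneq (c j) 0.
    by rewrite cj rmorph0 mul0r; split; [apply: subring0|left].
  apply: vmaxMl; [by []|exact: valuation_ring_cst|apply: smax].
  rewrite ltn_ord andbT ltn_neqAle imin // andbT eq_sym.
  exact: ji.
by move=> /vmax_unit; rewrite fmorph_eq0 => /(_ ci); rewrite -fmorphV; case;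
  apply: valuation_ring_cst.
Qed.

Lemma valuation_ring_center (V : set F) y :
  valuation_ring V -> V y -> ~ V y^-1 -> exists P : prime_of F, vge P 1 y.
Proof.
move=> Vval Vy Vy1; have [Vsub Vinv] := Vval.
apply: (@valuation_ring_prime _ V Vval); last 2 first.
- by apply: contra_notN Vy1 => /eqP ->; rewrite invr0; apply: subring0.
- by split=> //; right.
move=> v Vv v0; have [a [D [a0 Ha]]] := dominated v0.
have [HX HnX] := Ha _ Vval Vv.
(* The element a / T^E of k(T) is a multiple of v in V, so a chain of principal ideals above v also
   lies above it, and its length falls under the counting bound. E is 0 when T lies in V and D
   otherwise. *)
have [E VE] : exists E, V (al a / al 'X^E / v).
  have [VX|VX] := pselect (V (al 'X)); last by exists D; apply: HnX.
  by exists 0%N; rewrite expr0 rmorph1 divr1; apply: HX.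
have b0 : 'X^E != 0 :> {poly k} by rewrite expf_neq0 // polyX_eq0.
exists (n * (maxn (size a) E))%N => r s sV smax vs.
rewrite -[X in (X <= _)%N]card_ord.
apply: (@poly_free_card a 'X^E _ _ (fun i : 'I_r => s i)) => //.
- by rewrite (leq_trans (leq_maxl _ E)).
- by rewrite size_polyXn ltnS leq_maxr.
apply: chain_poly_free Vval _ sV smax _.
  by rewrite mulf_neq0 ?invr_eq0 ?al_neq0.
move=> i ir; have -> : al a / al 'X^E / s i = al a / al 'X^E / v * (v / s i).
  by rewrite mulrA divfK.
by apply: vmaxMl => //; apply: vs.
Qed.

Lemma evxM x p q : evx x (p * q) = evx x p * evx x q.
Proof. by rewrite /evx rmorphM hornerM. Qed.

Lemma evxX x : evx x 'X = x.
Proof. by rewrite /evx map_polyX hornerX. Qed.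

Lemma evx_is_subring y : is_subring [set evx y p | p in [set: {poly k}]].
Proof.
split.
- by exists 1 => //; rewrite /evx rmorph1 hornerC.
- by move=> _ _ [p _ <-] [q _ <-]; exists (p - q); rewrite ?evxB.
- by move=> _ _ [p _ <-] [q _ <-]; exists (p * q); rewrite ?evxM.
Qed.

(* When y is transcendental, y^-1 generates a proper ideal of k[y^-1], which is
   contained in the maximal ideal of some valuation ring. *)
Lemma no_pole_algebraic y : (forall P : prime_of F, vge P 0 y) ->
  exists2 phi, phi != 0 & evx y phi = 0.
Proof.
move=> Hy; have [->|y0] := eqVneq y 0.
  by exists 'X; rewrite ?evxX // polyX_eq0.
pose A := [set evx y^-1 p | p in [set: {poly k}]].
have [[phi _ E]|Ay] := pselect (A y).
  pose m := size phi.
  (* If y = phi(y^-1), multiplication by y^(m-1) gives the monic equation y^m = S(y) with S of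
     degree less than m. *)
  pose S := \sum_(i < m) phi`_i *: 'X^(m - i.+1) : {poly k}.
  exists ('X^m - S).
    apply/eqP => /(congr1 (fun p : {poly k} => p`_m)) /eqP.
    rewrite coefB coefXn eqxx coef0 [S`_m]coef_sum big1 ?subr0 ?oner_eq0 // => i _.
    by rewrite coefZ coefXn; case: eqP => [|_]; rewrite ?mulr0 //; have := ltn_ord i;
      lia.
  rewrite evxB; apply/eqP; rewrite subr_eq0; apply/eqP.
  have m0 : (0 < m)%N.
    rewrite lt0n size_poly_eq0; apply: contra_neq y0 => p0.
    by rewrite -E p0 /evx rmorph0 horner0.
  have -> : evx y 'X^m = y * y ^+ m.-1 by rewrite /evx map_polyXn hornerXn -exprS
    prednK.
  rewrite /evx rmorph_sum horner_sum -[X in X * _]E.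
  rewrite -[in LHS](coefK phi) evxE -/m mulr_suml; apply: eq_bigr => i _ /=.
  rewrite linearZ /= map_polyXn hornerZ hornerXn -mulrA; congr (_ * _).
  have im : (i <= m.-1)%N by have := ltn_ord i; lia.
  have -> : (m - i.+1 = m.-1 - i)%N by lia.
  by rewrite -{1}(subnKC im) exprD exprVn mulKf ?expf_neq0.
have [//||V [Vval AV Vy1]] := @exists_valuation_ring _ A y^-1 (evx_is_subring _).
- by exists 'X => //; rewrite evxX.
- by rewrite invrK.
have [||P] := valuation_ring_center Vval (y := y^-1).
- by apply: AV; exists 'X => //; rewrite evxX.
- by [].
have := Hy P; rewrite !vgeE ?invr_eq0 // ordV; lia.
Qed.

Lemma finite_zeros (a b : {poly k}) : a != 0 -> b != 0 ->
  exists2 s : seq (prime_of F), uniq s & forall P, P \in s <-> vge P 1 (al a / al b).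
Proof.
move=> a0 b0; pose d := maxn (size a) (size b).
apply: (bounded_uniq_finite (N := n * d)) => s us Hs.
have := @sum_ord_le a b d s (fun=> 1%N) (fun=> unit) (fun _ _ => 1) a0 b0.
rewrite (eq_bigr (fun=> 1%N)) => [|P _]; last by rewrite card_unit.
rewrite sum1_size; apply=> //.
- by rewrite (leq_trans (leq_maxl _ (size b))).
- by rewrite (leq_trans (leq_maxr (size a) _)).
- move=> P _; split=> [_|c]; first exact: vge01.
  rewrite (big_pred1 tt) ?mulr1; last by case.
  move=> Hc [] ; apply/eqP; apply: contraT => c0.
  by move: Hc; rewrite vgeE ?fmorph_eq0 // ord_cst.
- by move=> P /Hs; rewrite vgeE // mulf_neq0 ?invr_eq0 ?al_neq0.
Qed.

Lemma polyX_neq0 : 'X != 0 :> {poly k}.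
Proof. by rewrite polyX_eq0. Qed.

Lemma alX_neq0 : al 'X != 0.
Proof. exact/al_neq0/polyX_neq0. Qed.

Lemma vge_alV (P : prime_of F) : ~~ vge P 0 (al 'X) -> vge P 1 (al 1 / al 'X).
Proof.
move=> /vge_neg_pole [_ H]; rewrite rmorph1 div1r vgeE ?invr_eq0 ?alX_neq0 //.
by rewrite ordV; lia.
Qed.

(** Off the poles of T, a zero of w is a zero of the polynomial a given by [dominated], since a / w
    is integral there. The poles of T are the zeros of 1 / T, and the poles of z are the zeros of
    z^-1. *)
Lemma finite_support z : z != 0 ->
  exists2 s : seq (prime_of F), uniq s & forall P, ord P z != 0 -> P \in s.
Proof.
move=> z0; have [s0 _ Hs0] := finite_zeros (oner_neq0 _) polyX_neq0.
have H w : w != 0 -> exists s : seq (prime_of F), forall P, 0 < ord P w -> P \in s.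
  move=> w0; have [a [D [a0 Ha]]] := dominated w0.
  have [s1 _ Hs1] := finite_zeros a0 (oner_neq0 _).
  exists (s0 ++ s1) => P Pw; rewrite mem_cat.
  have [PX|PX] := boolP (vge P 0 (al 'X)); last first.
    by apply/orP; left; apply/Hs0; apply: vge_alV.
  apply/orP; right; apply/Hs1.
  have [] := Ha _ (valuation_ring_val P).
    by apply/val_ringE; rewrite vgeE // ltW.
  have /val_ringE PX' := PX; move=> /(_ PX') /val_ringE.
  rewrite rmorph1 divr1 !vgeE ?mulf_neq0 ?invr_eq0 ?al_neq0 //.
  by rewrite ordM ?invr_eq0 ?al_neq0 // ordV; lia.
have [s1 Hs1] := H _ z0; have [s2 Hs2] := H _ (invr_neq0 z0).
exists (undup (s1 ++ s2)); first exact: undup_uniq.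
move=> P Pz; rewrite mem_undup mem_cat; apply/orP.
have [Pz1|Pz1] := lerP (ord P z) 0; last by left; apply: Hs1.
by right; apply: Hs2; rewrite ordV; lia.
Qed.

(** [sum_ord_le] needs an element of k(T) vanishing at P. It comes from a uniformizer t: integrality
    of a / T^E / t forces a / T^E to have order at least 1. *)
Lemma residue_free_bound (P : prime_of F) : exists N : nat,
  forall (J : finType) (u : J -> F), residue_free P u -> (#|J| <= N)%N.
Proof.
have [t t0 t1] := uniformizer P.
have [a [D [a0 Ha]]] := dominated t0.
have [E Px] : exists E, vge P 1 (al a / al 'X^E).
  have [|HX HnX] := Ha _ (valuation_ring_val P).
    by apply/val_ringE; rewrite vgeE // t1.
  have [VX|VX] := pselect (val_ring P (al 'X)).
    exists 0%N; rewrite expr0 rmorph1 divr1.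
    have /val_ringE := HX VX; rewrite !vgeE ?mulf_neq0 ?invr_eq0 ?al_neq0 //.
    by rewrite ordM ?invr_eq0 ?al_neq0 // ordV t1; lia.
  have b0 : al 'X^D != 0 by apply: al_neq0; rewrite expf_neq0 ?polyX_neq0.
  exists D; have /val_ringE := HnX VX.
  have x0 : al a / al 'X^D != 0 by rewrite mulf_neq0 ?invr_eq0 // ?al_neq0.
  set x := al a / al 'X^D in x0 *.
  have xt0 : x / t != 0 by rewrite mulf_neq0 ?invr_eq0.
  by rewrite !vgeE // ordM ?invr_eq0 // ordV t1; lia.
have b0 : 'X^E != 0 :> {poly k} by rewrite expf_neq0 ?polyX_neq0.
exists (n * maxn (size a) E)%N => J u Hu.
have := @sum_ord_le a 'X^E (maxn (size a) E) [:: P] (fun=> 1%N) (fun=> J) (fun _ =>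
  u) a0 b0.
rewrite big_seq1 mul1n; apply=> //.
- by rewrite (leq_trans (leq_maxl _ E)).
- by rewrite size_polyXn ltnS leq_maxr.
- by move=> Q; rewrite inE => /eqP ->.
- by move=> Q; rewrite inE => /eqP ->; rewrite -vgeE // mulf_neq0 ?invr_eq0 ?al_neq0.
Qed.

(** * The field of constants and the residue fields *)

Local Notation kappa := (algebraicOver cstp).

Lemma ord_evx_pole (P : prime_of F) y phi : ord P y < 0 -> phi != 0 ->
  evx y phi != 0 /\ ord P (evx y phi) = ord P y *+ (size phi).-1.
Proof.
move=> ylt phi0.
have yn0 : y != 0 by apply: contraTneq ylt => ->; rewrite ord_zero ltxx.
have [m sm] : exists m, size phi = m.+1.
  by exists (size phi).-1; rewrite prednK // lt0n size_poly_eq0.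
have lc0 : cstp phi`_m != 0.
  by rewrite fmorph_eq0; move: phi0; rewrite -lead_coef_eq0 lead_coefE sm.
have olc : ord P (cstp phi`_m * y ^+ m) = ord P y *+ m.
  by rewrite ordM ?expf_neq0 // ord_cst ordX add0r.
rewrite -[phi in evx _ phi]coefK evxE sm big_ord_recr /= addrC -olc.
apply: ordD_lt; first by rewrite mulf_neq0 ?expf_neq0.
rewrite olc; apply: vge_sum => i _.
rewrite -(add0r (_ + 1)); apply: vgeM; first exact: vge_cst.
rewrite vgeE ?expf_neq0 // ordX -(mulr_natr _ i) -(mulr_natr _ m) !natz.
by have := ltn_ord i; nia.
Qed.

Lemma ord_algebraic (P : prime_of F) x : kappa x -> ord P x = 0.
Proof.
suff H y : kappa y -> 0 <= ord P y.
  move=> Kx; apply/le_anti; rewrite H // -oppr_ge0 -ordV H //.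
  exact: algebraic_inv.
move=> [phi phi0 /rootP y0]; rewrite leNgt; apply/negP => ylt.
by have [+ _] := ord_evx_pole ylt phi0; rewrite /evx y0 eqxx.
Qed.

Lemma vge_algebraic (P : prime_of F) x : kappa x -> vge P 0 x.
Proof. by move=> Kx; rewrite /vge ord_algebraic // lexx orbT. Qed.

Lemma algebraic_max_eq0 (P : prime_of F) x : kappa x -> vge P 1 x -> x = 0.
Proof. by move=> Kx; rewrite /vge ord_algebraic //= orbF => /eqP. Qed.

Lemma algebraicP (y : F) : kappa y <-> forall P : prime_of F, vge P 0 y.
Proof.
split=> [Ky P|/no_pole_algebraic [phi phi0 E]]; first exact: vge_algebraic.
by exists phi => //; apply/rootP.
Qed.

Lemma kappa_subring : is_subring (kappa : set F).
Proof.
by split; [apply: algebraic1|move=> x y; apply: algebraic_sub|move=> x y;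
  apply: algebraic_mul].
Qed.

Lemma cst_subring : is_subring [set cstp c | c in [set: k]].
Proof.
split; first by exists 1; rewrite ?rmorph1.
- by move=> _ _ [c _ <-] [c' _ <-]; exists (c - c'); rewrite ?rmorphB.
- by move=> _ _ [c _ <-] [c' _ <-]; exists (c * c'); rewrite ?rmorphM.
Qed.

Definition is_kappa_residue_basis (P : prime_of F) (d : nat) (e : 'I_d -> F) :=
  [/\ (forall i, val_ring P (e i)),
      (forall x, val_ring P x -> exists c : 'I_d -> F,
         (forall i, kappa (c i)) /\
         max_ideal P (x - \sum_(i < d) c i * e i))
    & (forall c : 'I_d -> F, (forall i, kappa (c i)) ->
         max_ideal P (\sum_(i < d) c i * e i) -> forall i, c i = 0)].

Lemma exists_kappa_residue_basis (P : prime_of F) :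
  exists d (e : 'I_d -> F), is_kappa_residue_basis P e.
Proof.
have [N HN] := residue_free_bound P.
apply: (@exists_basis _ kappa (val_ring P) (max_ideal P) N).
- exact: kappa_subring.
- by move=> c; apply: algebraic_inv.
- by move=> x y /max_idealE Mx /max_idealE My; apply/max_idealE/vgeD.
- move=> c x Kc /max_idealE Mx; apply/max_idealE; apply: vge0M => //.
  exact: vge_algebraic.
move=> d e eV efree; rewrite -(card_ord d); apply: (HN _ e); split.
  by move=> j; apply/val_ringE.
move=> c /max_idealE Mc j; apply/eqP; rewrite -(fmorph_eq0 cstp); apply/eqP.
by apply: (efree (fun j => cstp (c j))) => // i; apply: algebraic_id.
Qed.

(** A constant that vanishes at P is zero, so the constants embed into the residue field at P, whose
    dimension over k is bounded. *)
Lemma exists_kappa_basis (P : prime_of F) : exists s (eps : 'I_s -> F),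
  [/\ forall i, kappa (eps i),
   forall x, kappa x -> exists c : 'I_s -> k, x = \sum_i cstp (c i) * eps i &
   forall c : 'I_s -> k, \sum_i cstp (c i) * eps i = 0 -> forall i, c i = 0].
Proof.
have [N HN] := residue_free_bound P.
have [||||d e eK efree|s [eps [epsK epsspan epsfree]]] :=
    @exists_basis _ [set cstp c | c in [set: k]] kappa [set 0] N.
- exact: cst_subring.
- by move=> _ [c _ <-]; exists c^-1; rewrite ?fmorphV.
- by move=> x y -> ->; rewrite /= addr0.
- by move=> c x _ ->; rewrite /= mulr0.
- rewrite -(card_ord d); apply: (HN _ e); split.
    by move=> j; apply: vge_algebraic.
  move=> c Mc j; apply/eqP; rewrite -(fmorph_eq0 cstp); apply/eqP.
  apply: (efree (fun j => cstp (c j))) => [i|]; first by exists (c i).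
  apply: algebraic_max_eq0 Mc; elim/big_ind: _ => [|x y|i _].
  + exact: algebraic0.
  + exact: algebraic_add.
  + by apply: algebraic_mul => //; apply: algebraic_id.
exists s, eps; split=> //.
- move=> x /epsspan [c [/(_ _)/cid2-cK] /eqP].
  rewrite subr_eq0 => /eqP ->.
  exists (fun i => s2val (cK i)); apply: eq_bigr => i _.
  by rewrite (s2valP' (cK i)).
- move=> c E i; apply/eqP; rewrite -(fmorph_eq0 cstp); apply/eqP.
  by apply: (epsfree (fun j => cstp (c j))) => // j; exists (c j).
Qed.

Definition residue_span (P : prime_of F) (J : finType) (u : J -> F) :=
  forall x, vge P 0 x -> exists c : J -> k, vge P 1 (x - \sum_j cstp (c j) * u j).

(** * Riemann's inequality by counting, and the product formula *)

Section Pigeonhole.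
Variables (J : prime_of F -> finType) (u : forall P, J P -> F).
Hypotheses (ufree : forall P, residue_free P (@u P))
  (uspan : forall P, residue_span P (@u P)).

(** One more order of vanishing at P costs a factor |k|^f, where f = #|J P|: the differences with a
    fixed element, scaled to level 0 at P, are sorted by their residues. Finite sets with controlled
    differences play the role of subspaces. *)
Lemma pigeonhole_step (A : finType) (phi : A -> F) (S : {set A})
    (m : prime_of F -> int) (P : prime_of F) (M : nat) :
  {in S &, forall x y Q, vge Q (m Q) (phi x - phi y)} ->
  (M * #|k| ^ #|J P| < #|S|)%N ->
  exists2 S' : {set A}, (M < #|S'|)%N &
    {in S' &, forall x y Q, vge Q (m Q + (Q == P)%:Z) (phi x - phi y)}.
Proof.
move=> HS MS; have [t t0 t1] := uniformizer P.
have [x0 x0S] : exists x0, x0 \in S.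
  by apply/set0Pn; rewrite -card_gt0; apply: leq_ltn_trans MS.
have /choice[C HC] : forall y, exists c : {ffun J P -> k}, vge P 0 y ->
    vge P 1 (y - \sum_j cstp (c j) * u j).
  move=> y; have [/uspan[c Hc]|_] := boolP (vge P 0 y); last by exists [ffun=> 0].
  by exists (finfun c) => _; under eq_bigr do rewrite ffunE.
pose y x := (phi x - phi x0) * t ^ (- m P).
have [|c Mc] := @fiber_large _ {ffun J P -> k} S (fun x => C (y x)) M.
  by rewrite card_ffun.
exists [set x in S | C (y x) == c] => // x x'.
rewrite !inE => /andP[xS /eqP xc] /andP[x'S /eqP x'c] Q.
have [->|_] := eqVneq Q P; last by rewrite addr0; apply: HS.
have V z : z \in S -> vge P 0 (y z).
  by move=> zS; rewrite /y -(vge_exprz (m P) t0 t1); apply: HS.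
have := vgeB (HC _ (V _ xS)) (HC _ (V _ x'S)).
rewrite xc x'c opprB addrA subrK /y -mulrBl opprB addrA subrK => H.
have ot : ord P (t ^ m P) = m P.
  case: (m P) => j; first by rewrite -exprnP ordX t1 natz.
  by rewrite NegzE -invr_expz ordV -exprnP ordX t1 natz.
rewrite addrC -(divfK (expfz_neq0 (m P) t0) (phi x - phi x')).
by rewrite (vgeMr _ _ (expfz_neq0 (m P) t0) ot) invr_expz.
Qed.

Lemma pigeonhole_seq (A : finType) (phi : A -> F) (S : {set A})
    (m : prime_of F -> int) (r : seq (prime_of F)) (M : nat) :
  {in S &, forall x y Q, vge Q (m Q) (phi x - phi y)} ->
  (M * #|k| ^ (\sum_(P <- r) #|J P|) < #|S|)%N ->
  exists2 S' : {set A}, (M < #|S'|)%N &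
    {in S' &, forall x y Q, vge Q (m Q + (count_mem Q r)%:Z) (phi x - phi y)}.
Proof.
elim: r m S => [|P r IH] m S HS.
  rewrite big_nil muln1 => MS; exists S => // x y xS yS Q.
  by rewrite addr0; apply: HS.
rewrite big_cons expnD mulnA mulnAC.
move=> /(pigeonhole_step HS) [S1 MS1 HS1].
have [S2 MS2 HS2] := IH _ _ HS1 MS1; exists S2 => // x y xS yS Q.
by have := HS2 x y xS yS Q; rewrite /= eq_sym PoszD addrA.
Qed.

Lemma pigeonhole (A : finType) (phi : A -> F) (m : prime_of F -> int)
    (r : seq (prime_of F)) :
  injective phi -> (forall x y Q, vge Q (m Q) (phi x - phi y)) ->
  (#|k| ^ (\sum_(P <- r) #|J P|) < #|A|)%N ->
  exists2 z, z != 0 & forall Q, vge Q (m Q + (count_mem Q r)%:Z) z.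
Proof.
move=> phi_inj Hphi Hcard.
have [||S MS HS] := @pigeonhole_seq A phi [set: A] m r 1.
- by move=> x y _ _; apply: Hphi.
- by rewrite mul1n cardsT.
have [x [y [xS yS xy]]] := card_gt1P MS.
exists (phi x - phi y); last by move=> Q; apply: HS.
by rewrite subr_eq0 (inj_eq phi_inj).
Qed.

Lemma om_neq0 i : om i != 0.
Proof.
apply/eqP => omi.
have := om_free (p := fun j => (j == i)%:R).
rewrite (bigD1 i) //= omi mulr0 add0r big1 => [/(_ erefl i)/eqP|j /negPf ->].
  by rewrite eqxx oner_eq0.
by rewrite rmorph0 mul0r.
Qed.

Lemma exists_poly_zero (P : prime_of F) : vge P 0 (al 'X) ->
  exists2 a, a != 0 & vge P 1 (al a).
Proof.
move=> /val_ringE VX; have [t t0 t1] := uniformizer P.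
have [a [D [a0 Ha]]] := dominated t0.
have [|/(_ VX)/val_ringE H _] := Ha _ (valuation_ring_val P).
  by apply/val_ringE; rewrite vgeE // t1.
exists a => //; rewrite -(divfK t0 (al a)) -(add0r 1) -t1.
by apply: vgeM => //; rewrite vgeE.
Qed.

Lemma vge_al (P : prime_of F) p : vge P 0 (al 'X) -> vge P 0 (al p).
Proof. by move=> VX; rewrite -evx_X; apply: vge_evx. Qed.

Lemma exists_poly_zeros (D : prime_of F -> int) (s : seq (prime_of F)) :
  exists2 p, p != 0 & forall P, P \in s -> vge P 0 (al 'X) -> `|D P| <= ord P (al p).
Proof.
elim: s => [|Q s [p p0 Hp]]; first by exists 1; rewrite ?oner_neq0.
have ordal P q : q != 0 -> vge P 0 (al 'X) -> 0 <= ord P (al q).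
  by move=> q0 /(vge_al q); rewrite vgeE ?al_neq0.
have [/exists_poly_zero [a a0 Ha]|QX] := boolP (vge Q 0 (al 'X)); last first.
  exists p => // P; rewrite inE => /orP[/eqP -> QX'|/Hp //].
  by rewrite QX' in QX.
exists (a ^+ `|D Q| * p); first by rewrite mulf_neq0 ?expf_neq0.
move=> P; rewrite inE rmorphM rmorphXn ordM ?expf_neq0 ?al_neq0 // ordX.
rewrite -mulr_natr natz => /orP[/eqP ->|Ps] PX.
  have := ordal Q p p0 PX; move: Ha; rewrite vgeE ?al_neq0 //; nia.
have := Hp P Ps PX; have := ordal P a a0 PX; nia.
Qed.

(** The coefficient at P of the divisor of poles of T. *)
Let e (P : prime_of F) : nat := absz (Num.max 0 (ord P (al 1 / al 'X))%R).

Let ordX1 P : ord P (al 1 / al 'X) = - ord P (al 'X).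
Proof. by rewrite rmorph1 div1r ordV. Qed.

Let e_pole P : ~~ vge P 0 (al 'X) -> (e P)%:Z = - ord P (al 'X).
Proof.
by move=> /vge_neg_pole[_ H]; rewrite /e ordX1 max_r; lia.
Qed.

Let e_nopole P : vge P 0 (al 'X) -> e P = 0%N.
Proof. by rewrite vgeE ?alX_neq0 // /e ordX1 => H; rewrite max_l //; lia. Qed.

Lemma sum_pole_X (s : seq (prime_of F)) : uniq s ->
  (\sum_(P <- s) e P * #|J P| <= n)%N.
Proof.
move=> us; rewrite (bigID (fun P => vge P 0 (al 'X))) /=.
rewrite big1 ?add0n => [|P /e_nopole -> //].
rewrite -big_filter -[n in (_ <= n)%N]muln1.
apply: (@sum_ord_le 1 'X 1 _ e J u); rewrite ?oner_neq0 ?polyX_neq0 ?filter_uniq //.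
- by rewrite size_poly1.
- by rewrite size_polyX.
- by move=> P; rewrite mem_filter => /andP[/e_pole -> _]; rewrite ordX1.
Qed.

(** The zeros of p lie off the poles of T and weigh at most n deg p by [sum_ord_le]; at a pole of T
    the leading term gives the order - deg p [e P] exactly. The sum of e f is kept as it stands, so
    that it can be merged with the same sum in [riemann_weak]. *)
Lemma sum_ord_al (p : {poly k}) (s : seq (prime_of F)) : p != 0 -> uniq s ->
  \sum_(P <- s) ord P (al p) * #|J P|%:Z
    <= (n * (size p).-1)%:Z - (size p).-1%:Z * \sum_(P <- s) (e P * #|J P|)%:Z.
Proof.
move=> p0 us; rewrite (bigID (fun P => vge P 0 (al 'X))) /= [X in _ * X](bigID (fun P
  => vge P 0 (al 'X))) /=.
rewrite [X in _ * (X + _)]big1 => [|P /e_nopole -> //].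
rewrite add0r; apply: lerD; last first.
  rewrite -mulrN -sumrN mulr_sumr; apply: ler_sum => P PX.
  have [_ xlt] := vge_neg_pole PX.
  rewrite -(evx_X p); have [_ ->] := ord_evx_pole xlt p0.
  rewrite -mulr_natr natz PoszM e_pole //.
  by rewrite le_eqVlt; apply/orP; left; apply/eqP; ring.
pose s' := [seq P <- s | vge P 0 (al 'X)].
have : (\sum_(P <- s') `|ord P (al p)| * #|J P| <= n * (size p).-1)%N.
  apply: (@sum_ord_le p 1 (size p).-1 s' (fun P => `|ord P (al p)|%N) J u);
    rewrite ?oner_neq0 ?filter_uniq ?size_poly1 //.
    by rewrite prednK // lt0n size_poly_eq0.
  move=> P; rewrite mem_filter => /andP[/(vge_al p) + _].
  by rewrite vgeE ?al_neq0 // rmorph1 divr1; lia.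
rewrite -lez_nat; apply: le_trans; rewrite -big_filter -/s' (big_morph Posz PoszD
  erefl).
rewrite le_eqVlt; apply/orP; left; apply/eqP; apply: eq_big_seq => P.
rewrite mem_filter => /andP[/(vge_al p) + _]; rewrite vgeE ?al_neq0 // => H.
by rewrite PoszM gez0_abs.
Qed.

(** Bounds the poles of all basis elements at once; its weighted degree is the constant g of
    [riemann_weak]. *)
Let C (P : prime_of F) : nat := (\sum_b `|ord P (om b)|)%N.

Let combo m (c : {ffun 'I_n * 'I_m.+1 -> k}) : F :=
  \sum_b \sum_j cstp (c (b, j)) * (al 'X ^+ j * om b).

Lemma combo_al m c : @combo m c = \sum_b al (\poly_(j < m.+1) c (b, inord j)) * om b.
Proof.
apply: eq_bigr => b _; rewrite -[al (\poly_(j < _) _)]evx_X evxE mulr_suml.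
by apply: eq_bigr => j _; rewrite inord_val mulrA.
Qed.

Lemma combo_inj m : injective (@combo m).
Proof.
move=> c c'; rewrite !combo_al => /eqP; rewrite -subr_eq0 -sumrB => /eqP E.
pose q (c : {ffun 'I_n * 'I_m.+1 -> k}) b := \poly_(j < m.+1) c (b, inord j).
have q0 := om_free (p := fun b => q c b - q c' b).
apply/ffunP => -[b j].
have /q0/(_ b)/eqP : \sum_i al (q c i - q c' i) * om i = 0.
  by rewrite -[RHS]E; apply: eq_bigr => i _; rewrite rmorphB mulrBl.
rewrite subr_eq0 => /eqP /(congr1 (fun p : {poly k} => p`_j)).
by rewrite !coef_poly ltn_ord inord_val.
Qed.

Lemma vge_combo m c P : vge P (- (m * e P + C P)%:Z) (@combo m c).
Proof.
apply: vge_sum => b _; apply: vge_sum => j _; apply: vge0M; first exact: vge_cst.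
rewrite PoszD opprD; apply: vgeM.
  rewrite vgeE ?expf_neq0 ?alX_neq0 // ordX -mulr_natr natz.
  have [PX|PX] := boolP (vge P 0 (al 'X)).
    by rewrite e_nopole //; move: PX; rewrite vgeE ?alX_neq0 //; nia.
  rewrite PoszM e_pole //; have [_] := vge_neg_pole PX.
  by have := ltn_ord j; move: (ord P _); nia.
rewrite vgeE ?om_neq0 // /C (bigD1 b) //=; lia.
Qed.

(* The lower half of Riemann's inequality: the combinations of om with
   coefficients in k[T] of degree at most m form a space of dimension n (m + 1)
   in L(m (T)_oo + C), which exceeds the number of conditions cutting out the
   subspace L(D - div p), where the polynomial p moves D to the poles of T. *)
Lemma riemann_weak : exists g : int, forall (D : prime_of F -> int) s, uniq s ->
  (forall P, D P != 0 -> P \in s) -> g <= \sum_(P <- s) D P * #|J P|%:Z ->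
  exists2 z, z != 0 & forall P, vge P (- D P) z.
Proof.
have /choice[so Hso] : forall b, exists so : seq (prime_of F),
    forall P, ord P (om b) != 0 -> P \in so.
  by move=> b; have [so _ Hso] := finite_support (om_neq0 b); exists so.
pose sC := flatten [seq so b | b <- enum 'I_n].
have HsC P : C P != 0%N -> P \in sC.
  rewrite /C sum_nat_eq0 => /forallPn[b]; rewrite implyTb absz_eq0 => Hb.
  by apply/flattenP; exists (so b); [apply: map_f; rewrite mem_enum|apply: Hso].
exists (\sum_(P <- undup sC) (C P)%:Z * #|J P|%:Z) => D s us Ds Dg.
have [p p0 Hp] := exists_poly_zeros D s.
have [sp _ Hsp] := finite_support (al_neq0 p0).
have [sX _ HsX] := finite_support alX_neq0.
(* At a pole of T one has D2 = D + dp e with e >= 1, so this m gives D2 <= D1 there. At the other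
   places the zeros of p already make D2 nonpositive. *)
pose dp := (size p).-1; pose m := (dp + \sum_(P <- s) `|D P|)%N.
pose D1 P : int := (m * e P + C P)%:Z.
pose D2 P : int := D P - ord P (al p).
pose L := undup (sC ++ s ++ sp ++ sX).
have uL : uniq L by apply: undup_uniq.
have LC P : P \in sC -> P \in L by rewrite mem_undup !mem_cat => ->.
have Ls P : P \in s -> P \in L by rewrite mem_undup !mem_cat => ->; rewrite orbT.
have Lp P : ord P (al p) != 0 -> P \in L.
  by move=> /Hsp H; rewrite mem_undup !mem_cat H !orbT.
have Le P : e P != 0%N -> P \in L.
  move=> eP; have : P \in sX; last by move=> H; rewrite mem_undup !mem_cat H !orbT.
  by apply: HsX; apply: contra_neq eP; rewrite /e ordX1 => ->.
have D21 P : D2 P <= D1 P.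
  have DPs : D P != 0 -> P \in s := Ds P.
  have [PX|PX] := boolP (vge P 0 (al 'X)).
    rewrite /D1 /D2 e_nopole // muln0 add0n.
    have := vge_al p PX; rewrite vgeE ?al_neq0 // => H.
    have [D0|/DPs Ps] := eqVneq (D P) 0; first by rewrite D0; lia.
    by have := Hp _ Ps PX; lia.
  have [_ xlt] := vge_neg_pole PX.
  have [_] := ord_evx_pole xlt p0; rewrite evx_X -/dp -mulr_natr natz => op.
  have eE := e_pole PX.
  have [D0|/DPs Ps] := eqVneq (D P) 0.
    by rewrite /D1 /D2 D0 op /m; nia.
  have Dm : (`|D P| <= \sum_(P <- s) `|D P|)%N by rewrite (big_rem P) //= leq_addr.
  rewrite /D1 /D2 op /m; move: Dm (ord P (al 'X)) xlt eE.
  by move: (\sum_(P <- s) _)%N => S Dm o; nia.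
(* Each place is repeated as often as its order must be raised to pass from L(D1) to L(D2). *)
pose r := flatten [seq nseq `|D1 P - D2 P|%N P | P <- L].
have rL Q : D1 Q != D2 Q -> Q \in L.
  move=> H; apply: contraT => QL; case/negP: H; apply/eqP; rewrite /D1 /D2.
  have -> : e Q = 0%N by apply/eqP; apply: contraNT QL => /Le.
  have -> : C Q = 0%N by apply/eqP; apply: contraNT QL => /HsC/LC.
  have -> : D Q = 0 by apply/eqP; apply: contraNT QL => /Ds/Ls.
  have -> : ord Q (al p) = 0 by apply/eqP; apply: contraNT QL => /Lp.
  by rewrite muln0.
have rcount Q : (count_mem Q r)%:Z = D1 Q - D2 Q.
  rewrite count_flatten -map_comp sumnE big_map /=.
  rewrite (eq_bigr (fun P => if P == Q then `|D1 P - D2 P|%N else 0%N)); last first.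
    by move=> P _; rewrite count_nseq /=; case: eqP => _; rewrite ?mul1n ?mul0n.
  have [QL|QL] := boolP (Q \in L).
    rewrite (bigD1_seq Q) //= eqxx big1 ?addn0 => [|P /negPf -> //].
    by rewrite gez0_abs // subr_ge0.
  rewrite big1_seq => [|P /= PL]; last by case: eqP => // E; rewrite -E PL in QL.
  by apply/eqP; rewrite eq_sym subr_eq0; apply: contraNT QL; apply: rL.
have [z z0 Hz] : exists2 z, z != 0 & forall Q, vge Q (- D1 Q + (count_mem Q r)%:Z) z.
  apply: (@pigeonhole _ (@combo m) (fun Q => - D1 Q) r).
  - exact: combo_inj.
  - by move=> x y Q; apply: vgeB; apply: vge_combo.
  rewrite card_ffun card_prod !card_ord ltn_exp2l ?card_finNzRing_gt1 //.
  have -> : (\sum_(P <- r) #|J P| = \sum_(P <- L) `|D1 P - D2 P| * #|J P|)%N.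
    rewrite big_flatten big_map; apply: eq_bigr => P _.
    by rewrite big_nseq iter_addn_0 mulnC.
  rewrite -ltz_nat (big_morph Posz PoszD erefl).
  have -> : \sum_(P <- L) (`|D1 P - D2 P| * #|J P|)%N%:Z =
      m%:Z * \sum_(P <- L) (e P * #|J P|)%:Z + \sum_(P <- L) (C P)%:Z * #|J P|%:Z
      - \sum_(P <- L) D P * #|J P|%:Z + \sum_(P <- L) ord P (al p) * #|J P|%:Z.
    rewrite mulr_sumr -!big_split -sumrB -big_split; apply: eq_bigr => P _ /=.
    by rewrite PoszM gez0_abs ?subr_ge0 // /D1 /D2 PoszD !PoszM; ring.
  have -> : \sum_(P <- L) (C P)%:Z * #|J P|%:Z = \sum_(P <- undup sC) (C P)%:Z * #|J
    P|%:Z.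
    apply: big_supp; rewrite ?undup_uniq // => P;
      rewrite mulf_eq0 negb_or => /andP[H _].
      by apply: LC; apply: HsC.
    by rewrite mem_undup; apply: HsC.
  have -> : \sum_(P <- L) D P * #|J P|%:Z = \sum_(P <- s) D P * #|J P|%:Z.
    apply: big_supp => // P; rewrite mulf_eq0 negb_or => /andP[/Ds // H _].
    exact: Ls.
  (* With e the sum of e f, the exponent is at most (m - dp) e + n dp + g - deg D. Since e <= n, dp
     <= m and g <= deg D, this is at most n m, which is less than n (m + 1). *)
  have := sum_ord_al p0 uL; have := sum_pole_X uL.
  rewrite -lez_nat (big_morph Posz PoszD erefl).
  have := n_gt0; rewrite -/dp; move: Dg.
  have : (dp <= m)%N by rewrite leq_addr.
  move: (\sum_(P <- undup sC) _) (\sum_(P <- s) _ * _) (\sum_(P <- L) (_ * _)%N%:Z)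
    (\sum_(P <- L) _ * _).
  move: (m) => m' g d ee o; nia.
exists (z / al p); first by rewrite mulf_neq0 ?invr_eq0 ?al_neq0.
move=> P; have := Hz P; rewrite rcount addKr.
rewrite -(vgeMr _ z (n := - ord P (al p)) (invr_neq0 (al_neq0 p0))) ?ordV //.
by rewrite /D2 opprB addrAC subrr sub0r.
Qed.

(* If div y had positive degree, then L(M div y - P0) would be nonzero for M
   large, and multiplication by y^M would give a nonzero function without poles
   and with a zero at P0. *)
Lemma product_formula (P0 : prime_of F) z s : z != 0 -> uniq s ->
  (forall P, ord P z != 0 -> P \in s) -> \sum_(P <- s) ord P z * #|J P|%:Z = 0.
Proof.
have [g riemann] := riemann_weak.
suff H y : y != 0 -> uniq s -> (forall P, ord P y != 0 -> P \in s) ->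
    \sum_(P <- s) ord P y * #|J P|%:Z <= 0.
  move=> z0 us Hs; apply/le_anti; rewrite H //= -oppr_le0 -sumrN.
  rewrite (eq_bigr (fun P => ord P z^-1 * #|J P|%:Z)) => [|P _];
    last by rewrite ordV mulNr.
  by apply: H; rewrite ?invr_eq0 // => P; rewrite ordV oppr_eq0; apply: Hs.
move=> y0 us Hs; rewrite leNgt; apply/negP => dpos.
(* The degree of div y being at least 1, that of M div y - P0 is at least M - #|J P0| = |g|. *)
pose M := (`|g| + #|J P0|)%N.
pose D P := M%:Z * ord P y - (P == P0)%:Z.
pose L := undup (P0 :: s).
have uL : uniq L by apply: undup_uniq.
have P0L : P0 \in L by rewrite mem_undup mem_head.
have sL P : P \in s -> P \in L by rewrite mem_undup inE orbC => ->.
have DL P : D P != 0 -> P \in L.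
  have [->//|PP0] := eqVneq P P0.
  rewrite /D (negPf PP0) subr0 mulf_eq0 negb_or => /andP[_ /Hs]; exact: sL.
have DE : \sum_(P <- L) D P * #|J P|%:Z
    = M%:Z * \sum_(P <- s) ord P y * #|J P|%:Z - #|J P0|%:Z.
  rewrite (eq_bigr (fun P => M%:Z * (ord P y * #|J P|%:Z) - (P == P0)%:Z * #|J P|%:Z)).
    rewrite sumrB -mulr_sumr; congr (_ * _ - _).
      apply: big_supp => // P; rewrite mulf_eq0 negb_or => /andP[/Hs //].
      by move=> ? _; apply: sL.
    rewrite (bigD1_seq P0) //= eqxx mul1r big1 ?addr0 // => P /negPf ->.
    by rewrite mul0r.
  by move=> P _; rewrite /D mulrBl mulrA.
have [|w w0 Hw] := riemann D L uL DL.
  by rewrite DE /M; move: dpos; move: (\sum_(P <- s) _) => d; nia.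
pose v := w * y ^+ M.
have v0 : v != 0 by rewrite mulf_neq0 ?expf_neq0.
have Hv P : vge P (P == P0)%:Z v.
  have := vgeM (Hw P) (n := M%:Z * ord P y) (y := y ^+ M).
  rewrite /D opprB subrK; apply.
  by rewrite vgeE ?expf_neq0 // ordX -mulr_natr natz mulrC.
have /algebraicP Kv : forall P, vge P 0 v by move=> P; apply: vge_le (Hv P).
by move/eqP: v0; apply; apply: (algebraic_max_eq0 (P := P0) Kv); have := Hv P0;
  rewrite eqxx.
Qed.

(* If the residue field at P has at most N elements, then two of 1, T, ..., T^N
   are congruent at P, unless P is a pole of T. *)
Lemma finite_bounded_weight (B : nat) : exists s : seq (prime_of F),
  forall P, (#|J P| <= B)%N -> P \in s.
Proof.
have [sX _ HsX] := finite_support alX_neq0.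
pose N := (#|k| ^ B).+1.
pose p : {poly k} := \prod_(ij : 'I_N * 'I_N | (ij.1 < ij.2)%N) ('X^(ij.2) - 'X^(ij.1)).
have p0 : p != 0.
  apply/prodf_neq0 => -[i j] /= ij; apply/eqP => /(congr1 (fun q : {poly k} => q`_j))
    /eqP.
  by rewrite coefB !coefXn eqxx coef0 gtn_eqF // subr0 oner_eq0.
have [sp _ Hsp] := finite_support (al_neq0 p0).
exists (sX ++ sp) => P PB; rewrite mem_cat; apply/orP.
have [PX|PX] := boolP (vge P 0 (al 'X)); last first.
  by left; apply: HsX; have [_] := vge_neg_pole PX; lia.
right; apply: Hsp.
suff : vge P 1 (al p) by rewrite vgeE ?al_neq0 //; lia.
have /choice[c Hc] : forall i : 'I_N, exists c : {ffun J P -> k},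
    vge P 1 (al 'X^i - \sum_j cstp (c j) * u j).
  move=> i; have [c Hc] := uspan (vge_al 'X^i PX).
  by exists (finfun c); under eq_bigr do rewrite ffunE.
have /injectivePn[i [j ij cij]] : ~~ injectiveb c.
  apply/negP => /injectiveP /leq_card; rewrite card_ffun card_ord leqNgt ltnS.
  by rewrite leq_pexp2l // ltnW // card_finNzRing_gt1.
wlog {ij} ij : i j cij / (i < j)%N.
  move=> H; have [ij'|ji|/val_inj E] := ltngtP i j; [exact: (H i j)|exact: (H j i)|].
  by rewrite E eqxx in ij.
rewrite /p (bigD1 (i, j)) //= rmorphM mulrC; apply: vge0M; first exact: vge_al.
have := vgeB (Hc j) (Hc i); rewrite cij opprB addrA subrK.
by rewrite -rmorphB.
Qed.

End Pigeonhole.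

(** The tower k, kappa, residue field: products of a basis of kappa over k with a residue basis over
    kappa. The factor s = [kappa : k] is independent of P. *)
Lemma exists_residue_basis (deg : prime_of F -> nat) (P0 : prime_of F) :
  (forall P, exists e : 'I_(deg P) -> F, is_kappa_residue_basis P e) ->
  exists s, (0 < s)%N /\ exists u : forall P, 'I_s * 'I_(deg P) -> F,
    (forall P, residue_free P (@u P)) /\ (forall P, residue_span P (@u P)).
Proof.
move=> Hdeg; have [s [eps [epsK epsspan epsfree]]] := exists_kappa_basis P0.
exists s; split.
  rewrite lt0n; apply/eqP => s0; have [c] := epsspan 1 (algebraic1 _).
  rewrite big1 => [/eqP|[i im]]; first by rewrite oner_eq0.
  by exfalso; rewrite s0 in im.
have H P : { u : 'I_s * 'I_(deg P) -> F | residue_free P u /\ residue_span P u }.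
  apply: cid; have [e [eV espan efree]] := Hdeg P.
  exists (fun ij => eps ij.1 * e ij.2); split; first split.
  - move=> ij; apply: vge0M; first exact/vge_algebraic/epsK.
    exact/val_ringE/eV.
  - move=> c Hc [i j]; move: Hc.
    have Kc j' : kappa (\sum_i' cstp (c (i', j')) * eps i').
      elim/big_ind: _ => [|x y|i' _]; [exact: algebraic0|exact: algebraic_add|].
      by apply: algebraic_mul => //; apply: algebraic_id.
    rewrite (eq_bigr (fun ij => cstp (c (ij.1, ij.2)) * (eps ij.1 * e ij.2)));
      last by case.
    rewrite -(pair_big xpredT xpredT (fun i j => cstp (c (i, j)) * (eps i * e j))) /=
      exchange_big /=.
    move=> /max_idealE Hc; apply: (epsfree (fun i' => c (i', j))).
    apply: (efree (fun j' => \sum_i' cstp (c (i', j')) * eps i')) => //.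
    rewrite (eq_bigr (fun j' => \sum_i' cstp (c (i', j')) * (eps i' * e j'))) // =>
      j' _.
    by rewrite mulr_suml; apply: eq_bigr => i' _; rewrite mulrA.
  - move=> x /val_ringE /espan [c [cK /max_idealE Hx]].
    have /choice[b Hb] : forall j, exists b : 'I_s -> k, c j = \sum_i cstp (b i) *
      eps i.
      by move=> j; apply: epsspan.
    exists (fun ij => b ij.2 ij.1).
    rewrite -(pair_big xpredT xpredT (fun i j => cstp (b j i) * (eps i * e j))) /=
      exchange_big /=.
    rewrite (eq_bigr (fun j => c j * e j)) // => j _.
    by rewrite Hb mulr_suml; apply: eq_bigr => i _; rewrite mulrA.
by exists (fun P => sval (H P)); split=> P; case: (H P) => u [].
Qed.

Lemma is_kappa_residue_basis_gt0 P d (e : 'I_d -> F) : is_kappa_residue_basis P e ->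
  (0 < d)%N.
Proof.
case=> _ espan _; rewrite lt0n; apply/eqP => d0; subst d.
have [c [_]] := espan 1 (proj2 (val_ringE P 1) (vge01 P)).
rewrite big_ord0 subr0 => /max_idealE; exact/negP/vge11.
Qed.

End FunctionField.

(** * Divisor classes of a global function field *)

Lemma fraction_decomp (R : idomainType) (x : {fraction R}) :
  exists d n : R, d != 0 /\ FracField.tofrac d * x = FracField.tofrac n.
Proof.
elim/quotW: x => x; exists \d_x, \n_x; split; first exact: denom_ratioP.
unlock FracField.tofrac; rewrite -[LHS]FracField.pi_mul /=.
apply/eqmodP; rewrite /= FracField.equivfE /FracField.mulf /=.
by rewrite !numden_Ratio ?mulf_neq0 ?oner_neq0 ?denom_ratioP // !mul1r mulr1 mulrC.
Qed.

(** * Extensions of F_ell(T): degrees, principal divisors and torsion classes *)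

Section GlobalFunctionField.
Variables (ell : nat) (F : global_function_field ell) (Pinf : prime_of F).

Definition poly_embed (p : {poly 'F_ell}) : F := (FracField.tofrac p)%:A.

HB.instance Definition _ := GRing.RMorphism.copy poly_embed
  (in_alg F \o @FracField.tofrac {poly 'F_ell}).

Let n := \dim {:F}.
Let om (i : 'I_n) : F := (vbasis {:F})`_i.

Lemma poly_embed_inj : injective poly_embed.
Proof.
move=> p q /(fmorph_inj (in_alg F)) /eqP; by rewrite tofrac_eq => /eqP.
Qed.

Lemma vbasis_free_poly (p : 'I_n -> {poly 'F_ell}) :
  \sum_i poly_embed (p i) * om i = 0 -> forall i, p i = 0.
Proof.
move=> E i; apply: poly_embed_inj; rewrite rmorph0 /poly_embed.
have /freeP H := basis_free (vbasisP {:F}).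
rewrite (H (fun i => FracField.tofrac (p i))) ?scale0r //.
by rewrite -[RHS]E; apply: eq_bigr => j _; rewrite mulr_algl.
Qed.

Lemma vbasis_span_poly (z : F) : exists g, exists2 p : 'I_n -> {poly 'F_ell},
  g != 0 & poly_embed g * z = \sum_i poly_embed (p i) * om i.
Proof.
have /choice[gp Hgp] : forall i : 'I_n, exists gp : {poly 'F_ell} * {poly 'F_ell},
    gp.1 != 0 /\ FracField.tofrac gp.1 * coord (vbasis {:F}) i z = FracField.tofrac
      gp.2.
  by move=> i; have [d [m Hdm]] := fraction_decomp (coord (vbasis {:F}) i z);
    exists (d, m).
exists (\prod_i (gp i).1).
exists (fun i => \prod_(j | j != i) (gp j).1 * (gp i).2).
  by apply/prodf_neq0 => i _; case: (Hgp i).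
rewrite {1}(coord_vbasis (memvf z)) mulr_sumr; apply: eq_bigr => i _.
rewrite /poly_embed !mulr_algl scalerA; congr (_ *: _).
by rewrite (bigD1 i) //= rmorphM mulrC mulrA [_ * FracField.tofrac (gp i).1]mulrC
  (Hgp i).2 mulrC rmorphM.
Qed.

Lemma constantsP (y : F) : constants F y <-> forall P : prime_of F, vge P 0 y.
Proof. exact: (algebraicP (al := poly_embed) poly_embed_inj vbasis_span_poly). Qed.

Lemma prime_degreeP (P : prime_of F) :
  exists e : 'I_(prime_degree P) -> F, is_residue_basis P e.
Proof.
rewrite /prime_degree; apply: (@xgetPex _ 0%N [set d | exists e : 'I_d -> F,
  is_residue_basis P e]).
exact: (exists_kappa_residue_basis (al := poly_embed) poly_embed_inj vbasis_span_poly
  P).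
Qed.

Lemma prime_degree_gt0 (P : prime_of F) : (0 < prime_degree P)%N.
Proof.
by have [e /(is_kappa_residue_basis_gt0 (al := poly_embed))] := prime_degreeP P.
Qed.

Lemma degree_residue_basis : exists s, (0 < s)%N /\
  exists u : forall P : prime_of F, 'I_s * 'I_(prime_degree P) -> F,
    (forall P, residue_free poly_embed P (@u P)) /\
    (forall P, residue_span poly_embed P (@u P)).
Proof.
exact: (exists_residue_basis (al := poly_embed) poly_embed_inj vbasis_span_poly Pinf
  prime_degreeP).
Qed.

Lemma ord_degree_sum (z : F) (s : seq (prime_of F)) : z != 0 -> uniq s ->
  (forall P, ord P z != 0 -> P \in s) ->
  \sum_(P <- s) ord P z * (prime_degree P)%:Z = 0.
Proof.
move=> z0 us Hs; have [m [m0 [u [ufree uspan]]]] := degree_residue_basis.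
have := product_formula poly_embed_inj vbasis_free_poly vbasis_span_poly ufree uspan
  Pinf z0 us Hs.
rewrite (eq_bigr (fun P => m%:Z * (ord P z * (prime_degree P)%:Z))) => [|P _];
  last first.
  by rewrite card_prod !card_ord PoszM mulrCA.
by rewrite -mulr_sumr => /eqP; rewrite mulf_eq0 => /orP[/eqP|/eqP//]; lia.
Qed.

Lemma riemann_degree : exists g : nat, forall (D : prime_of F -> int) s, uniq s ->
  (forall P, D P != 0 -> P \in s) ->
  g%:Z <= \sum_(P <- s) D P * (prime_degree P)%:Z ->
  exists2 z, z != 0 & forall P, vge P (- D P) z.
Proof.
have [m [m0 [u [ufree uspan]]]] := degree_residue_basis.
have [g Hg] := riemann_weak poly_embed_inj vbasis_free_poly vbasis_span_poly ufree
  uspan.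
exists `|g|%N => D s us Ds Dg; apply: (Hg D s us Ds).
rewrite (eq_bigr (fun P => m%:Z * (D P * (prime_degree P)%:Z))) => [|P _]; last first.
  by rewrite card_prod !card_ord PoszM mulrCA.
by rewrite -mulr_sumr; move: Dg; move: (\sum_(P <- s) _) => d; nia.
Qed.

Lemma finite_bounded_degree (B : nat) : exists s : seq (prime_of F),
  forall P, (prime_degree P <= B)%N -> P \in s.
Proof.
have [m [m0 [u [ufree uspan]]]] := degree_residue_basis.
have [s Hs] := finite_bounded_weight poly_embed_inj vbasis_span_poly uspan (m * B).
by exists s => P PB; apply: Hs; rewrite card_prod !card_ord leq_mul2l PB orbT.
Qed.

Lemma exists_divisor (d : prime_of F -> int) (s : seq (prime_of F)) : uniq s ->
  (forall P, d P != 0 -> P \in s) ->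
  exists D : divisor F, forall P, coeff P D = d P.
Proof.
move=> us Hs; exists (\sum_(P <- s) << d P *g P >>) => P; rewrite raddf_sum /=.
rewrite (eq_bigr (fun Q => if Q == P then d P else 0)) => [|Q _]; last first.
  by rewrite coeffU; case: eqP => [->|_]; rewrite ?mulr1 ?mulr0.
have [Ps|Ps] := boolP (P \in s).
  by rewrite (bigD1_seq P) //= eqxx big1 ?addr0 // => Q /negPf ->.
have -> : d P = 0 by apply/eqP; apply: contraNT Ps; apply: Hs.
by rewrite big1 // => Q _; rewrite if_same.
Qed.

Lemma div_degree_sum (D : divisor F) (s : seq (prime_of F)) : uniq s ->
  (forall P, coeff P D != 0 -> P \in s) ->
  div_degree D = \sum_(P <- s) coeff P D * (prime_degree P)%:Z.
Proof.
move=> us Hs; apply: big_supp; rewrite ?uniq_dom // => P;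
  rewrite mulf_eq0 negb_or => /andP[H _]; last exact: Hs.
by rewrite mem_dom.
Qed.

Lemma div_degree_principal (D : divisor F) : is_principal D -> div_degree D = 0.
Proof.
move=> [z z0 Dz]; rewrite /div_degree (eq_bigr (fun P => ord P z * (prime_degree
  P)%:Z)).
  by apply: ord_degree_sum => //; [apply: uniq_dom|move=> P; rewrite -Dz mem_dom].
by move=> P _; rewrite Dz.
Qed.

Lemma div_degreeMn (D : divisor F) N : div_degree (D *+ N) = div_degree D *+ N.
Proof.
rewrite (@div_degree_sum (D *+ N) (dom D)) ?uniq_dom // => [|P].
  by rewrite /div_degree -sumrMnl; apply: eq_bigr => P _; rewrite coeffMn mulrnAl.
by rewrite coeffMn mem_dom; apply: contraNN => /eqP ->; rewrite mul0rn.
Qed.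

Lemma is_principalB (D E : divisor F) : is_principal D -> is_principal E ->
  is_principal (D - E).
Proof.
move=> [z z0 Dz] [y y0 Ey]; exists (z / y); first by rewrite mulf_neq0 ?invr_eq0.
by move=> P; rewrite coeffB Dz Ey ordM ?invr_eq0 // ordV.
Qed.

Lemma is_principal0 : is_principal (0 : divisor F).
Proof. by exists 1; rewrite ?oner_neq0 // => P; rewrite coeff0 ord_one. Qed.

Lemma is_principalN (D : divisor F) : is_principal D -> is_principal (- D).
Proof. by rewrite -sub0r => HD; apply: is_principalB => //; apply: is_principal0. Qed.

Lemma is_principalD (D E : divisor F) : is_principal D -> is_principal E ->
  is_principal (D + E).
Proof. by move=> HD HE; rewrite -(opprK E); apply/is_principalB/is_principalN. Qed.

Lemma is_principalMn (D : divisor F) N : is_principal D -> is_principal (D *+ N).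
Proof.
move=> HD; elim: N => [|N IH]; first by rewrite mulr0n; apply: is_principal0.
by rewrite mulrS; apply: is_principalD.
Qed.

Lemma div_class_eq (D E : divisor F) : is_principal (E - D) ->
  div_class D = div_class E.
Proof.
move=> ED; apply/seteqP; rewrite /div_class; split=> X /= HX.
  have -> : X - E = (X - D) - (E - D) by rewrite opprB addrA subrK.
  exact: is_principalB.
have -> : X - D = (X - E) + (E - D) by rewrite addrA subrK.
exact: is_principalD.
Qed.

Lemma div_class_self (D : divisor F) : div_class D D.
Proof. by rewrite /div_class /= subrr; apply: is_principal0. Qed.

(* If deg Pinf = 1, every class of degree 0 contains E - N Pinf with E
   effective of a fixed degree N, and there are finitely many such E. *)
Lemma class_group_finite (N : nat) : prime_degree Pinf = 1%N ->
  finite_set (class_group_torsion F N).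
Proof.
move=> deg1; have [g riemann] := riemann_degree.
have [S0 HS0] := finite_bounded_degree g.
pose S := undup S0.
have uS : uniq S by apply: undup_uniq.
have HS P : (prime_degree P <= g)%N -> P \in S by move=> /HS0; rewrite mem_undup.
pose G (c : {ffun 'I_(size S) -> 'I_g.+1}) : set (divisor F) :=
  div_class (\sum_i << (c i : nat)%:Z *g (tnth (in_tuple S) i) >> - << g%:Z *g Pinf >>).
apply: (@sub_finite_set _ _ [set G c | c in [set: _]]); last first.
  by apply: finite_image; apply: finite_finset.
move=> _ [D [D0 _] <-].
pose D1 P : int := coeff P D + (P == Pinf)%:Z * g%:Z.
pose L := undup (Pinf :: dom D).
have uL : uniq L by apply: undup_uniq.
have PinfL : Pinf \in L by rewrite mem_undup mem_head.
have D1E : \sum_(P <- L) D1 P * (prime_degree P)%:Z = g%:Z.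
  rewrite (eq_bigr (fun P => coeff P D * (prime_degree P)%:Z + (P == Pinf)%:Z * g%:Z
    * (prime_degree P)%:Z)).
    rewrite big_split /= -div_degree_sum // => [|P].
      rewrite D0 add0r (bigD1_seq Pinf) //= eqxx mul1r deg1 mulr1 big1 ?addr0 //.
      by move=> P /negPf ->; rewrite !mul0r.
    by rewrite -mem_dom mem_undup inE orbC => ->.
  by move=> P _; rewrite /D1 mulrDl.
have D1L P : D1 P != 0 -> P \in L.
  have [->//|/negPf PP] := eqVneq P Pinf.
  by rewrite /D1 PP mul0r addr0 -mem_dom mem_undup inE orbC => ->.
have [|z z0 Hz] := riemann D1 L uL D1L; first by rewrite D1E.
have [sz usz Hsz] := finite_support (al := poly_embed) poly_embed_inj
  vbasis_span_poly z0.
pose E P := ord P z + D1 P.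
have E0 P : 0 <= E P by have := Hz P; rewrite vgeE // /E; lia.
pose L2 := undup (L ++ sz).
have uL2 : uniq L2 by apply: undup_uniq.
have LL2 P : P \in L -> P \in L2 by rewrite [P \in L2]mem_undup mem_cat => ->.
have szL2 P : P \in sz -> P \in L2 by rewrite mem_undup mem_cat orbC => ->.
have EE : \sum_(P <- L2) E P * (prime_degree P)%:Z = g%:Z.
  rewrite (eq_bigr (fun P => ord P z * (prime_degree P)%:Z + D1 P * (prime_degree
    P)%:Z)).
    rewrite big_split /= ord_degree_sum // => [|P /Hsz /szL2 //].
    rewrite add0r -D1E; apply: big_supp => // P; rewrite mulf_eq0 negb_or => /andP[H _].
      by apply: LL2; apply: D1L.
    exact: D1L.
  by move=> P _; rewrite /E mulrDl.
(* No term of a nonnegative sum exceeds its total g. This confines the support of E to S and its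
   coefficients to at most g, leaving finitely many E. *)
have Eg P : E P * (prime_degree P)%:Z <= g%:Z.
  have [PL2|PL2] := boolP (P \in L2).
    rewrite -EE (bigD1_seq P) //= lerDl; apply: sumr_ge0 => Q _.
    by rewrite mulr_ge0.
  have -> : E P = 0; last by rewrite mul0r.
  rewrite /E; have -> : ord P z = 0 by apply/eqP; apply: contraNT PL2 => /Hsz /szL2.
  by apply/eqP; rewrite add0r; apply: contraNT PL2 => /D1L /LL2.
have ES P : E P != 0 -> P \in S.
  by move=> EP; apply: HS; have := Eg P; have := E0 P; nia.
have Elt P : (`|E P| < g.+1)%N.
  by have := Eg P; have := E0 P; have := prime_degree_gt0 P; nia.
exists [ffun i => inord `|E (tnth (in_tuple S) i)|%N] => //.
symmetry; apply: div_class_eq; exists z => // Q.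
rewrite !coeffB coeffU raddf_sum /=.
rewrite (eq_bigr (fun i => (fun P => if P == Q then E Q else 0) (tnth (in_tuple S) i))).
  rewrite -(big_tnth _ _ S xpredT (fun P => if P == Q then E Q else 0)).
  have -> : \sum_(P <- S) (if P == Q then E Q else 0) = E Q.
    have [QS|QS] := boolP (Q \in S).
      by rewrite (bigD1_seq Q) //= eqxx big1 ?addr0 // => P /negPf ->.
    have -> : E Q = 0 by apply/eqP; apply: contraNT QS; apply: ES.
    by rewrite big1 // => P _; rewrite if_same.
  by rewrite /E /D1 eq_sym; case: eqP => _ /=; ring.
move=> i _; rewrite ffunE coeffU inordK //; case: eqP => [->|_]; last by rewrite mulr0.
by rewrite mulr1 gez0_abs.
Qed.

(* Equal cardinalities of [fset_set]s only give equal sets because the class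
   group is finite: [fset_set] is empty on infinite sets. *)
Lemma torsion_descent (N M : nat) (D : divisor F) : prime_degree Pinf = 1%N ->
  (M %| N)%N -> class_number_torsion F N = class_number_torsion F M ->
  div_degree D = 0 -> is_principal (D *+ N) -> is_principal (D *+ M).
Proof.
move=> deg1 MN cardE D0 DN.
have finN := class_group_finite N deg1; have finM := class_group_finite M deg1.
have sub : class_group_torsion F M `<=` class_group_torsion F N.
  move=> _ [E [E0 EM] <-]; exists E => //; split=> //.
  by rewrite -(divnK MN) mulnC mulrnA; apply: is_principalMn.
have E : fset_set (class_group_torsion F M) = fset_set (class_group_torsion F N).
  apply/eqP; rewrite eqEfcard; apply/andP; split.
    by rewrite -fset_set_sub.
  by move: cardE; rewrite /class_number_torsion => ->.
have : class_group_torsion F N (div_class D) by exists D.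
rewrite -(fset_setK finN) -E fset_setK // => -[D' [_ D'M] DD'].
have : div_class D' D by rewrite DD'; apply: div_class_self.
rewrite /div_class /= => DD.
have -> : D *+ M = (D - D') *+ M + D' *+ M by rewrite mulrnBl subrK.
by apply: is_principalD => //; apply: is_principalMn.
Qed.

(** * Constants, residues at Pinf, and q-th powers with constant difference *)

Let constantsE x : constants F x = algebraicOver (cstp poly_embed) x.
Proof. by []. Qed.

Lemma constantsB x y : constants F x -> constants F y -> constants F (x - y).
Proof. by rewrite !constantsE; apply: algebraic_sub. Qed.

Lemma constantsM x y : constants F x -> constants F y -> constants F (x * y).
Proof. by rewrite !constantsE; apply: algebraic_mul. Qed.

Lemma constantsV x : constants F x -> constants F x^-1.
Proof. by rewrite !constantsE; apply: algebraic_inv. Qed.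

Lemma constantsX x m : constants F x -> constants F (x ^+ m).
Proof.
move=> Kx; elim: m => [|m IH]; first by rewrite constantsE; apply: algebraic1.
by rewrite exprS; apply: constantsM.
Qed.

Lemma ord_constants (P : prime_of F) x : constants F x -> ord P x = 0.
Proof. by rewrite constantsE; apply: ord_algebraic. Qed.

Lemma vge_constants (P : prime_of F) x : constants F x -> vge P 0 x.
Proof. by move=> /constantsP. Qed.

Lemma constants_max_eq0 (P : prime_of F) x : constants F x -> vge P 1 x -> x = 0.
Proof. by move=> Kx; rewrite /vge ord_constants //= orbF => /eqP. Qed.

Lemma residue_constant x : prime_degree Pinf = 1%N -> vge Pinf 0 x ->
  exists2 r, constants F r & vge Pinf 1 (x - r).
Proof.
move=> deg1 Vx; have := prime_degreeP Pinf.
rewrite deg1 => -[e [eV espan _]].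
have span y : vge Pinf 0 y -> exists2 c, constants F c & vge Pinf 1 (y - c * e ord0).
  move=> /val_ringE /espan [c [cK]]; rewrite big_ord1 => /max_idealE H.
  by exists (c ord0).
(* The single basis element e need not be 1. Since 1 is congruent to c1 e and x to c2 e, x is
   congruent to c2 / c1. *)
have [c1 K1 H1] := span 1 (vge01 Pinf); have [c2 K2 H2] := span x Vx.
have c10 : c1 != 0.
  by apply: contraNneq (vge11 Pinf) => c10; move: H1; rewrite c10 mul0r subr0.
exists (c2 / c1); first by apply: constantsM => //; apply: constantsV.
have -> : x - c2 / c1 = (x - c2 * e ord0) - (c2 / c1) * (1 - c1 * e ord0) by field.
apply: vgeB => //; apply: vge0M => //; apply: vge_constants.
by apply: constantsM => //; apply: constantsV.
Qed.

Lemma ord_natr (P : prime_of F) (q : nat) : prime ell -> prime q -> q <> ell ->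
  (q%:R : F) != 0 /\ ord P (q%:R : F) = 0.
Proof.
move=> ell_prime q_prime qell.
have -> : (q%:R : F) = cstp poly_embed q%:R by rewrite rmorph_nat.
rewrite ord_cst fmorph_eq0 -(dvdn_pcharf (pchar_Fp ell_prime)); split=> //.
by rewrite dvdn_prime2 //; apply/eqP => /esym.
Qed.

Lemma mulrn_lt0 (o : int) (m : nat) : o < 0 -> (0 < m)%N -> o *+ m <= -1.
Proof. by move=> o0 m0; rewrite -mulr_natr natz; nia. Qed.

(* Scaling gamma by a constant makes beta / gamma congruent to 1 at Pinf; then
   beta - gamma divides the constant beta^q - gamma^q with a cofactor that has
   a pole at Pinf, so it has a zero at Pinf and no pole at all. *)
Lemma no_constant_difference (q : nat) (b g c d : F) :
  prime ell -> prime q -> q <> ell -> prime_degree Pinf = 1%N ->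
  constants F c -> constants F d -> c != 0 -> d != 0 ->
  (forall P, P <> Pinf -> vge P 0 b) -> (forall P, P <> Pinf -> vge P 0 g) ->
  ord Pinf b < 0 -> ord Pinf g = ord Pinf b ->
  constants F (c * b ^+ q - d * g ^+ q) -> c * b ^+ q - d * g ^+ q = 0.
Proof.
move=> ell_prime q_prime qell deg1 Kc Kd c0 d0 bV gV blt gb Ke.
have b0 : b != 0 by apply: contraTneq blt => ->; rewrite ord_zero ltxx.
have g0 : g != 0 by apply: contraTneq blt => g0; rewrite -gb g0 ord_zero ltxx.
have q1 := prime_gt1 q_prime.
have ov : ord Pinf (b / g) = 0 by rewrite ordM ?invr_eq0 // ordV gb subrr.
have v0 : b / g != 0 by rewrite mulf_neq0 ?invr_eq0.
have vV : vge Pinf 0 (b / g) by rewrite vgeE // ov.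
have [r Kr Hr] := residue_constant deg1 vV.
have r0 : r != 0.
  by apply/eqP => r0; move: Hr; rewrite r0 subr0 vgeE // ov.
have rV := vge_constants Pinf Kr.
(* c r^q - d is a constant with a zero at Pinf: the constant difference vanishes there once divided
   by g^q, and b / g is congruent to r. *)
have dE : d = c * r ^+ q.
  apply/eqP; rewrite eq_sym -subr_eq0; apply/eqP;
    apply: (constants_max_eq0 (P := Pinf)).
    by apply: constantsB => //; apply: constantsM => //; apply: constantsX.
  have -> : c * r ^+ q - d
      = (c * b ^+ q - d * g ^+ q) / g ^+ q - c * ((b / g) ^+ q - r ^+ q).
    by rewrite expr_div_n; have := expf_neq0 q g0; move: (g ^+ q) => G G0; field.
  apply: vgeB.
    apply: vge0M; first exact: vge_constants.
    have gq0 : (g ^+ q)^-1 != 0 by apply/invr_neq0/expf_neq0.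
    by rewrite vgeE // ordV ordX gb lerNr mulrn_lt0 // prime_gt0.
  apply: vge0M; first exact: vge_constants.
  rewrite subrXX -(addr0 1); apply: vgeM => //; apply: vge_sum => i _.
  by apply: vge0M; apply: vgeX.
set h := r * g.
have h0 : h != 0 by rewrite mulf_neq0.
have oh : ord Pinf h = ord Pinf b by rewrite ordM // (ord_constants _ Kr) add0r.
have e'E : c * b ^+ q - d * g ^+ q = c * (b ^+ q - h ^+ q).
  by rewrite dE /h exprMn; ring.
rewrite e'E; suff -> : b = h by rewrite subrr mulr0.
have w1 : vge Pinf 1 (b / h - 1).
  have -> : b / h - 1 = r^-1 * (b / g - r) by rewrite /h; field; rewrite r0 g0.
  by apply: vge0M => //; apply/vge_constants/constantsV.
have [w0 ow] := ord_cong1 w1.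
pose S := \sum_(i < q) b ^+ (q.-1 - i) * h ^+ i.
have SE : b ^+ q - h ^+ q = (b - h) * S by rewrite subrXX.
have [S0 oS] : S != 0 /\ ord Pinf S = ord Pinf b *+ q.-1.
  (* As b / h is congruent to 1, S has leading term q h^(q-1). The factor q is a nonzero constant
     because q differs from the characteristic, so S has a pole of the expected order. *)
  have SE2 : S = h ^+ q.-1 * (q%:R + \sum_(i < q) ((b / h) ^+ (q.-1 - i) - 1)).
    rewrite sumrB sumr_const card_ord addrC subrK mulr_sumr; apply: eq_bigr => i _.
    have iq : (i <= q.-1)%N by rewrite -ltnS prednK ?ltn_ord ?prime_gt0.
    rewrite expr_div_n -{2}(subnKC iq) exprD -mulrA [h ^+ (q.-1 - i) * _]mulrC divfK
      ?expf_neq0 //.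
    by rewrite mulrC.
  have [q0 oq] := ord_natr Pinf ell_prime q_prime qell.
  have [T0 oT] : q%:R + \sum_(i < q) ((b / h) ^+ (q.-1 - i) - 1) != 0 /\
     ord Pinf (q%:R + \sum_(i < q) ((b / h) ^+ (q.-1 - i) - 1)) = 0.
    suff Hs : vge Pinf (ord Pinf (q%:R : F) + 1) (\sum_(i < q) ((b / h) ^+ (q.-1 - i)
      - 1)).
      by have := ordD_lt q0 Hs; rewrite oq.
    rewrite oq add0r; apply: vge_sum => i _.
    rewrite -[X in _ - X](expr1n _ (q.-1 - i)) subrXX -(addr0 1).
    apply: vgeM => //; apply: vge_sum => j _; rewrite expr1n mulr1.
    by apply: vgeX; rewrite vgeE // ow.
  by rewrite SE2 mulf_neq0 ?expf_neq0 // ordM ?expf_neq0 // oT addr0 ordX oh.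
have [->//|bh] := eqVneq b h; exfalso.
have cKe : constants F (b ^+ q - h ^+ q).
  by rewrite -[_ - _](mulKf c0) -e'E; apply: constantsM => //; apply: constantsV.
have bh0 : b - h != 0 by rewrite subr_eq0.
have obh : ord Pinf (b - h) + ord Pinf S = 0.
  by rewrite -ordM // -SE ord_constants.
have om' : ord Pinf b *+ q.-1 <= -1 by apply: mulrn_lt0 => //;
  rewrite -ltnS prednK ?prime_gt0.
have bhV : constants F (b - h).
  apply/constantsP => P; have [->|/eqP PP] := eqVneq P Pinf.
    by rewrite vgeE // -(addrK (ord Pinf S) (ord _ _)) obh oS sub0r lerNr (le_trans
      om').
  apply: vgeB; first exact: bV.
  by apply: vge0M; [apply: vge_constants|apply: gV].
by move: obh om'; rewrite (ord_constants _ bhV) oS add0r => ->.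
Qed.

(** * The linear factors X - a_i of a nonconstant solution *)

Section LinearFactors.
Variables (q k t : nat) (a0 : F) (a : 'I_t -> F) (m : 'I_t -> nat) (X Y : F).
Hypotheses (q_prime : prime q) (k_gt0 : (0 < k)%N) (deg1 : prime_degree Pinf = 1%N).
Hypotheses (a0K : constants F a0) (a0_neq0 : a0 != 0).
Hypotheses (aK : forall i, constants F (a i)) (a_inj : injective a).
Hypotheses (XnK : ~ constants F X) (XV : forall P, P <> Pinf -> vge P 0 X).
Hypothesis XY : Y ^+ (q ^ k) = a0 * \prod_i (X - a i) ^+ m i.
Hypothesis k_stable : class_number_torsion F (q ^ k) = class_number_torsion F (q ^ (k
  - 1)).

Lemma linear_factor_neq0 i : X - a i != 0.
Proof. by rewrite subr_eq0; apply: contra_notN XnK => /eqP ->. Qed.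

Lemma linear_factor_pole i :
  ord Pinf X < 0 /\ ord Pinf (X - a i) = ord Pinf X.
Proof.
have X0 : X != 0.
  by apply: contra_notN XnK => /eqP ->; apply/constantsP => P; apply: vge0.
have Xlt : ord Pinf X < 0.
  rewrite ltNge; apply: contra_notN XnK => XP; apply/constantsP => P.
  by have [->|/eqP /XV //] := eqVneq P Pinf; rewrite vgeE.
split=> //; apply: (proj2 (ordD_lt X0 _)); rewrite vgeN.
by apply: vge_le (vge_constants Pinf (aK i)); rewrite -ltzD1 ltrD2r.
Qed.

Lemma linear_factor_finite i P : ~~ (q %| m i)%N -> P <> Pinf ->
  exists d : int, ord P (X - a i) = d * (q ^ k)%N%:Z.
Proof.
move=> qm PPinf; have xi0 := linear_factor_neq0 i.
have xiV : vge P 0 (X - a i) by apply: vgeB; [exact: XV|exact: vge_constants].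
have [o0|o0] := eqVneq (ord P (X - a i)) 0; first by exists 0; rewrite o0 mul0r.
have [u0 ou] : a0 * \prod_(j | j != i) (X - a j) ^+ m j != 0 /\
    ord P (a0 * \prod_(j | j != i) (X - a j) ^+ m j) = 0.
  suff [p0 op] : \prod_(j | j != i) (X - a j) ^+ m j != 0 /\
      ord P (\prod_(j | j != i) (X - a j) ^+ m j) = 0.
    by rewrite mulf_neq0 // ordM // op ord_constants.
  elim/big_ind: _ => [|x y [x0 ox] [y0 oy]|j ji].
  - by rewrite oner_neq0 ord_one.
  - by rewrite mulf_neq0 // ordM // ox oy.
  have aij : a i - a j != 0 by rewrite subr_eq0 (inj_eq a_inj) eq_sym.
  have Kij : constants F (a i - a j) by apply: constantsB.
  (* This is X - a j, a nonzero constant plus an element with a zero at P, hence of order 0. *)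
  have [xj0 oj] : (a i - a j) + (X - a i) != 0 /\
      ord P ((a i - a j) + (X - a i)) = ord P (a i - a j).
    apply: ordD_lt => //; rewrite (ord_constants _ Kij) add0r vgeE //.
    by rewrite -gtz0_ge1 lt_neqAle eq_sym o0 -vgeE.
  rewrite addrC addrA subrK in xj0 oj.
  by rewrite expf_neq0 // ordX oj ord_constants // mul0rn.
have := congr1 (ord P) XY; rewrite (bigD1 i) //= mulrCA ordM ?expf_neq0 // ou addr0
  !ordX.
move: (ord P Y) (ord P (X - a i)) => y o E.
suff /dvdnP[d dE] : (q ^ k %| `|o|)%N.
  exists (Num.sg o * d%:Z); rewrite -mulrA -PoszM -dE abszE.
  exact: numEsg.
have cop : coprime (q ^ k) (m i) by rewrite coprimeXl // prime_coprime.
rewrite -(Gauss_dvdr _ cop) -[m i]absz_nat -abszM -natz mulrC mulr_natr -E.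
by rewrite -mulr_natr natz abszM absz_nat dvdn_mull.
Qed.

Lemma linear_factor_divisor i P : ~~ (q %| m i)%N ->
  exists d : int, ord P (X - a i) = d * (q ^ k)%N%:Z.
Proof.
move=> qm; have [->|/eqP] := eqVneq P Pinf; last exact: linear_factor_finite.
have xi0 := linear_factor_neq0 i.
have /choice[d Hd] : forall Q, exists d : int, Q <> Pinf -> ord Q (X - a i) = d * (q
  ^ k)%N%:Z.
  move=> Q; have [->|/eqP /(linear_factor_finite qm)[d dE]] := eqVneq Q Pinf;
    first by exists 0.
  by exists d.
have [s us Hs] := finite_support (al := poly_embed) poly_embed_inj vbasis_span_poly xi0.
pose L := undup (Pinf :: s).
have uL : uniq L by apply: undup_uniq.
have := ord_degree_sum xi0 uL; rewrite (bigD1_seq Pinf) ?mem_undup ?mem_head //= deg1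
  mulr1.
move=> sum0; exists (- \sum_(Q <- L | Q != Pinf) d Q * (prime_degree Q)%:Z).
apply/eqP; rewrite mulNr -addr_eq0 mulr_suml -[X in _ == X]sum0 => [|Q /Hs QS];
  last first.
  by rewrite mem_undup inE QS orbT.
by apply/eqP; congr (_ + _); apply: eq_bigr => Q /eqP /Hd ->; rewrite mulrAC.
Qed.

Lemma linear_factor_power i : ~~ (q %| m i)%N ->
  exists b c, [/\ b != 0, c != 0, constants F c & X - a i = c * b ^+ q].
Proof.
move=> qm; have xi0 := linear_factor_neq0 i.
have /choice[d Hd] := fun P => @linear_factor_divisor i P qm.
have qk0 : (0 < q ^ k)%N by rewrite expn_gt0 prime_gt0.
have [s us Hs] := finite_support (al := poly_embed) poly_embed_inj vbasis_span_poly xi0.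
have [|D DE] := @exists_divisor d s us.
  by move=> P dP; apply: Hs; rewrite Hd mulf_neq0 // -lt0n.
have DN : is_principal (D *+ q ^ k).
  by exists (X - a i) => // P; rewrite coeffMn DE Hd -mulr_natr natz.
have D0 : div_degree D = 0.
  have := div_degree_principal DN; rewrite div_degreeMn -mulr_natr natz => /eqP.
  by rewrite mulf_eq0 => /orP[/eqP //|]; rewrite eqz_nat; case: (q ^ k)%N qk0.
have [b b0 Hb] : is_principal (D *+ q ^ (k - 1)).
  by apply: torsion_descent D0 DN; rewrite // dvdn_exp2l // leq_subr.
have bq0 : b ^+ q != 0 by rewrite expf_neq0.
have u0 : (X - a i) / b ^+ q != 0 by rewrite mulf_neq0 ?invr_eq0.
(* From div b = q^(k-1) D one gets div b^q = q^k D = div (X - a i), so the quotient has no poles and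
   is constant. *)
exists b, ((X - a i) / b ^+ q); split=> //; last by rewrite divfK.
apply/constantsP => P; rewrite vgeE // ordM ?invr_eq0 // ordV ordX -Hb Hd coeffMn DE.
by rewrite -mulrnA -expnSr subn1 prednK // -mulr_natr natz subrr.
Qed.

End LinearFactors.

End GlobalFunctionField.

Theorem theorem2p4 (ell : nat) (ell_prime : prime ell)
    (F : global_function_field ell)
    (Pinf : prime_of F) (Pinf_deg1 : prime_degree Pinf = 1%N)
    (f : {poly F}) (f_const : forall i : nat, constants F f`_i)
    (q : nat) (q_prime : prime q) (q_neq_ell : q <> ell)
    (k : nat) (k_gt0 : (0 < k)%N)
    (k_stable :
      class_number_torsion F (q ^ k) = class_number_torsion F (q ^ (k - 1)))
    (k_least : forall j : nat, (0 < j)%N ->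
      class_number_torsion F (q ^ j) = class_number_torsion F (q ^ (j - 1)) ->
      (k <= j)%N)
    (t : nat) (a0 : F) (a : 'I_t -> F) (n : 'I_t -> nat)
    (f_factor : f = a0 *: \prod_(i < t) ('X - (a i)%:P) ^+ n i)
    (a0_const : constants F a0) (a0_neq0 : a0 != 0)
    (a_const : forall i, constants F (a i)) (a_inj : injective a)
    (n_gt0 : forall i, (0 < n i)%N) (t_ge2 : (2 <= t)%N)
    (n_ndvd : (2 <= #|[pred i : 'I_t | ~~ (q %| n i)%N]|)%N) :
  forall X Y : F,
    ring_of_integers Pinf X -> ring_of_integers Pinf Y ->
    Y ^+ (q ^ k) = f.[X] ->
    constants F X /\ constants F Y.
Proof.
move=> X Y XO YO YX.
have XY : Y ^+ (q ^ k) = a0 * \prod_i (X - a i) ^+ n i.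
  rewrite YX f_factor hornerZ horner_prod; congr (_ * _); apply: eq_bigr => i _.
  by rewrite horner_exp hornerXsubC.
have OV x : ring_of_integers Pinf x -> forall P, P <> Pinf -> vge P 0 x.
  by move=> Ox P /Ox; rewrite /vge => ->; rewrite orbT.
have XK : constants F X.
  apply: contrapT => XnK; have XV := OV _ XO.
  have [i [j [+ + ij]]] := card_gt1P n_ndvd; rewrite !inE => qi qj.
  have pw i' : ~~ (q %| n i')%N -> exists b c, [/\ b != 0, c != 0, constants F c & X
    - a i' = c * b ^+ q].
    exact: (linear_factor_power q_prime k_gt0 Pinf_deg1 a0_const a0_neq0 a_const
      a_inj XnK XV XY).
  have [b [c [b0 c0 Kc bE]]] := pw _ qi; have [g [d [g0 d0 Kd gE]]] := pw _ qj.
  have qgt0 := prime_gt0 q_prime.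
  have Vroot P z e i' : e != 0 -> constants F e -> z != 0 -> X - a i' = e * z ^+ q ->
      ord P (X - a i') = ord P z *+ q.
    by move=> e0 Ke z0 ->; rewrite ordM ?expf_neq0 // ord_constants // add0r ordX.
  have poleb := linear_factor_pole a_const XnK XV.
  have [Xlt obE] := poleb i; have [_ ogE] := poleb j.
  rewrite (Vroot _ _ _ _ c0 Kc b0 bE) in obE.
  rewrite (Vroot _ _ _ _ d0 Kd g0 gE) in ogE.
  have V z e i' : e != 0 -> constants F e -> z != 0 -> X - a i' = e * z ^+ q ->
      forall P, P <> Pinf -> vge P 0 z.
    move=> e0 Ke z0 zE P PP; rewrite vgeE // -(pmulrn_lge0 _ qgt0) -(Vroot P z e i') //.
    rewrite -vgeE ?(linear_factor_neq0 a_const XnK) //.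
    by apply: vgeB; [exact: XV|exact: vge_constants].
  (* This constant is nonzero because the roots are distinct, whereas [no_constant_difference] makes
     it zero. *)
  have E : c * b ^+ q - d * g ^+ q = a j - a i by rewrite -bE -gE; ring.
  have := @no_constant_difference _ _ Pinf q b g c d ell_prime q_prime q_neq_ell
    Pinf_deg1 Kc Kd c0 d0
    (V _ _ _ c0 Kc b0 bE) (V _ _ _ d0 Kd g0 gE).
  rewrite E -(pmulrn_llt0 _ qgt0) obE => /(_ Xlt) H.
  have aji : a j - a i = 0.
    apply: H; last exact: constantsB.
    by apply/eqP; rewrite -(eqr_pMn2r qgt0) ogE obE.
  move/eqP: aji; rewrite subr_eq0 (inj_eq a_inj) eq_sym; exact/negP.
(* Once X is constant, so is Y^(q^k); its order is zero at every place, hence Y has no poles. *)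
split=> //; apply/constantsP => P; have [->|Y0] := eqVneq Y 0; first exact: vge0.
rewrite vgeE // -(pmulrn_lge0 _ (n := q ^ k)) ?expn_gt0 ?prime_gt0 // -ordX XY.
have KZ : constants F (a0 * \prod_i (X - a i) ^+ n i).
  apply: constantsM => //; elim/big_ind: _ => [|x y|i _].
  - exact: (constantsX 0 XK).
  - exact: constantsM.
  - by apply: constantsX; apply: constantsB.
by rewrite ord_constants.
Qed.
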